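(* Let $M\ge3$ and $0<t\le k-1$ be integers. The sum $$G=G_{g,M}:=\sum_{\gamma\in\Gamma(M)}(1,\gamma^{-1})\cdot G_g$$ converges uniformly on compact subsets of $\mathcal H^2\setminus\{(z,z')\mid z\in\Gamma(M)z'\}$ and gives a well-defined section of the bundle $\mathrm{Hom}(\mathrm{pr}_1^*\mathcal W_0,\mathrm{pr}_2^*\mathcal W_0)$ on $(C\times C)\setminus\Delta_C$, where $C=Y(M)_{\mathbb C}$ and $\Delta_C$ is the diagonal.
   Context: Put $p=k-1$, $z=x+iy\in\mathcal H$, $j(\gamma,z)=cz+d$ for $\gamma=\begin{pmatrix}a&b\\c&d\end{pmatrix}$. Let $V=\mathbb R^2$ with basis $u_1,u_2$ be the standard representation of $\mathrm{GL}_2(\mathbb R)^+$. Let $A$ be a CM elliptic curve, $A(\mathbb C)=\mathbb C/\langle1,\tau_0\rangle$, and let $U=\mathbb C\mu_0\oplus\mathbb C\mu_{2t}$ be a two-dimensional space with trivial group action (realizing $H^{0,2t}(A^{2t})\oplus H^{2t,0}(A^{2t})$, Tate-twisted by $t$; $\mu_0$ has type $(-t,t)$ and $\mu_{2t}$ type $(t,-t)$). $\widetilde{\mathcal W}$ is the bundle on $\mathcal H$ with constant fibre $\mathrm{Sym}^{2k-2}(V_{\mathbb C})\otimes U$ (Tate-twisted to weight $0$), where at $z$ the vector $zu_1+u_2$ has type $(1,0)$ and $\bar zu_1+u_2$ type $(0,1)$. Its subbundle $\widetilde{\mathcal W}_0$ of vectors of type $(0,0)$ has rank 2 with $C^\infty$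 basis $$w^{+}(z)=\xi^{-1}y^{t-p}(zu_1+u_2)^{p+t}(\bar zu_1+u_2)^{p-t}\otimes\mu_0,\quad w^-(z)=\xi^{-1}y^{-p-t}(zu_1+u_2)^{p-t}(\bar zu_1+u_2)^{p+t}\otimes\mu_{2t},$$ with $\xi^{-1}=\binom{2p}{p+t}^{1/2}(2\pi i)^p2^{-p}$. For $\gamma\in\mathrm{SL}_2(\mathbb Z)$ one has $\gamma\cdot w^\pm(z)=j(\gamma,z)^{\pm2t}w^\pm(\gamma z)$. The bundle $\mathcal W_0$ on $C(\mathbb C)$ (a disjoint union of $\varphi(M)$ copies of $\Gamma(M)\backslash\mathcal H$) is the quotient of $\widetilde{\mathcal W}_0$ by $\Gamma(M)$ on each component; sections of $\mathrm{Hom}(\mathrm{pr}_1^*\mathcal W_0,\mathrm{pr}_2^*\mathcal W_0)$ are given, on each component, by $\Gamma(M)\times\Gamma(M)$-invariant sections upstairs, with action $$((\gamma,\gamma')\cdot G)(z,z')(w^\pm(z))=\gamma'\cdot G(\gamma^{-1}z,\gamma'^{-1}z')(\gamma^{-1}\cdot w^\pm(z)).$$ For $x>1$ let $Q_{k,t}(x)=\int_{-\infty}^\infty\frac{2^{2t}\,dw}{(x+\sqrt{x^2-1}\cosh w)^{k-t}(x+1+\sqrt{x^2-1}\,e^w)^{2t}}$ and, for $z\ne z'$, $$g(z,z')=-Q_{k,t}\Big(1+\frac{|z-z'|^2}{2yy'}\Big),\quad\mu_g^+(z,z')=g(z,z')\Big(\frac{z-\bar z'}{2iy'}\Big)^{2t},\quad\mu_g^-(z,z')=g(z,z')\Big(\frac{\bar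 z-z'}{2iy}\Big)^{2t}.$$ $G_g$ is the section over $(\mathcal H\times\mathcal H)\setminus\Delta_{\mathcal H}$ defined by $G_g(z,z')(w^\pm(z))=\mu_g^\pm(z,z')w^\pm(z')$. (Explicitly $G(z,z')(w^\pm(z))=\sum_{\gamma\in\Gamma(M)}j(\gamma,z')^{\mp2t}\mu_g^\pm(z,\gamma z')\,w^\pm(z')$.) *)

(* Defs.v *)
From HB Require Import structures.
From mathcomp Require Import all_boot all_order all_algebra.
From mathcomp Require Import finmap.
From mathcomp Require Import all_classical all_reals all_analysis.
From mathcomp Require Import summability.
(* The notations of mpoly are incompatible with those of mathcomp-analysis. *)
From mathcomp Require Import -(notations) mpoly.
From mathcomp Require Import complex ring zify.

Set Implicit Arguments.
Unset Strict Implicit.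
Unset Printing Implicit Defensive.

Import Order.TTheory GRing.Theory Num.Theory.
Import numFieldNormedType.Exports.

Local Open Scope ring_scope.
Local Open Scope classical_set_scope.
Local Open Scope complex_scope.

(* The usual topology of the complex numbers. *)
HB.instance Definition _ (R : rcfType) := NormedModule.copy R[i] R[i]^o.

Section UpperHalfPlane.
Variable R : realType.

(* Points of the upper half plane are complex numbers z with 0 < Im z;
   matrices have their entries in R, so that SL_2(Z) and its subgroups act
   through [intmx]. *)
Definition intmx (g : 'M[int]_2) : 'M[R]_2 := map_mx intr g.

Definition autj (g : 'M[R]_2) (z : R[i]) : R[i] :=
  (g 1 0)%:C * z + (g 1 1)%:C.

Definition mobius (g : 'M[R]_2) (z : R[i]) : R[i] :=
  ((g 0 0)%:C * z + (g 0 1)%:C) / autj g z.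

End UpperHalfPlane.

Definition in_Gamma (M : nat) (g : 'M[int]_2) : bool :=
  (\det g == 1) &&
  [forall i, forall j, (g i j == (1%:M : 'M[int]_2) i j %[mod M])%Z].

Definition Gamma (M : nat) := {g : 'M[int]_2 | in_Gamma M g}.

Definition Gamma_mx (R : realType) (M : nat) (g : Gamma M) : 'M[R]_2 :=
  intmx R (val g).

(* Let C = Y(M)_C: the components of C(C) are indexed by (Z/M)^*, each being
   Gamma(M)\H.  The
   inverse image in H x H of the intersection of the component (c, c') of C x C
   with the complement of the diagonal: *)
Definition off_diag (R : realType) (M : nat) (c c' : {unit 'Z_M}) : set (R[i] * R[i]) :=
  [set zz | [/\ 0 < complex.Im zz.1, 0 < complex.Im zz.2 &
     c = c' -> forall g : Gamma M, zz.1 <> mobius (Gamma_mx R g) zz.2]].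
Arguments off_diag R {M} c c'.

(* Sym^{2k-2}(V_C), realized as the homogeneous polynomials of degree 2k-2
   over C in the basis u_1, u_2 of V = R^2. *)
Section SymmetricPower.
Variables (R : realType) (k : nat).

Definition Sym := dhomog 2 R[i] (2 * k - 2).

Definition ubasis (i : 'I_2) : mpoly 2 R[i] := mpolyX R[i] (mnm1 i).

Definition linform (z : R[i]) : mpoly 2 R[i] := z *: ubasis 0 + ubasis 1.

(* Action induced by the standard representation g u_j = \sum_i g_ij u_i. *)
Definition sym_subst (g : 'M[R]_2) (P : mpoly 2 R[i]) : mpoly 2 R[i] :=
  comp_mpoly [tuple \sum_(i < 2) (g i j)%:C *: ubasis i | j < 2] P.

Lemma sym_subst_homog (g : 'M[R]_2) (P : Sym) :
  sym_subst g (val P) \is ishomog1 (2 * k - 2) mdeg.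
Proof.
rewrite /sym_subst comp_mpolyEX big_seq; apply: rpred_sum => m mP.
have ed : (2 * k - 2 = \sum_i m i)%N.
  by rewrite -mdegE; apply/esym; apply: (dhomog_mf (dhomog_is_dhomog P) mP).
apply: rpredZ; rewrite comp_mpolyX ed.
elim/big_rec2: _ => [|i q e _ he]; first exact: dhomog1.
apply: dhomogM => //; rewrite -[X in ishomog1 X]mul1n; apply: dhomogMn.
rewrite tnth_mktuple; apply: rpred_sum => j _; apply: rpredZ.
by rewrite dhomogX /= mdeg1.
Qed.

Definition sym_act (g : 'M[R]_2) (P : Sym) : Sym :=
  DHomog (sym_subst_homog g P).

(* (z u_1 + u_2)^a (zbar u_1 + u_2)^b if a, b >= 0 and a + b = 2k - 2, and 0
   otherwise: a generator of the part of type (a, b) of Sym^{2k-2}(V_C) at z,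
   before any Tate twist. *)
Definition hodge_vec (z : R[i]) (a b : int) : Sym :=
  match a, b with
  | Posz a', Posz b' =>
      indhomog (2 * k - 2) (linform z ^+ a' * linform (conjc z) ^+ b')
  | _, _ => 0
  end.

End SymmetricPower.

(* The constant fibre Sym^{2k-2}(V_C) (x) U, where the pair (f, h) stands for
   f (x) mu_0 + h (x) mu_{2t}. *)
Section Bundle.
Variables (R : realType) (k t : nat).

Local Notation p := (k - 1)%N (only parsing).

Definition Wfibre : vectType R[i] := (Sym R k * Sym R k)%type.

(* The group acts trivially on U. *)
Definition Wact (g : 'M[R]_2) (v : Wfibre) : Wfibre :=
  (sym_act g v.1, sym_act g v.2).

(* The part of type (r, s) at z: mu_0 has type (-t, t), mu_{2t} has type
   (t, -t), and the Tate twist to weight 0 lowers types by (p, p). *)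
Definition Whodge (z : R[i]) (r s : int) : {vspace Wfibre} :=
  (<[((hodge_vec k z (r + t%:Z + p%:Z) (s - t%:Z + p%:Z), 0%R) : Wfibre)]> +
   <[((0%R, hodge_vec k z (r - t%:Z + p%:Z) (s + t%:Z + p%:Z)) : Wfibre)]>)%VS.

Definition W0 (z : R[i]) : {vspace Wfibre} := Whodge z 0 0.

Definition xi_inv : R[i] :=
  (Num.sqrt 'C(2 * p, p + t)%:R)%:C * (2 * pi%:C * 'i) ^+ p * 2 ^- p.

Definition wplus (z : R[i]) : Wfibre :=
  ((xi_inv * (complex.Im z ^ (t%:Z - p%:Z))%:C) *:
     hodge_vec k z (p%:Z + t%:Z) (p%:Z - t%:Z), 0).

Definition wminus (z : R[i]) : Wfibre :=
  (0, (xi_inv * (complex.Im z ^ (- p%:Z - t%:Z))%:C) *: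
     hodge_vec k z (p%:Z - t%:Z) (p%:Z + t%:Z)).

(* The basis (w^+(z), w^-(z)) of the fibre at z, see [w_frame_basis]. *)
Definition w_frame (z : R[i]) : 2.-tuple (subvs_of (W0 z)) :=
  [tuple vsproj (W0 z) (wplus z); vsproj (W0 z) (wminus z)].

(* Families of linear maps between the fibres of W0 at z and at z'; only the
   values on the open set over which a section lives are relevant. *)
Definition hom_family : Type :=
  forall z z' : R[i], 'Hom(subvs_of (W0 z), subvs_of (W0 z')).

(* The matrix of G(z, z') in the frames (w^+, w^-) at z and z'. These frames are
   C^oo, so continuity and locally uniform convergence of sections are those of
   their matrices. *)
Definition hom_mx (G : hom_family) (zz : R[i] * R[i]) : 'M[R[i]]_2 :=
  \matrix_(i, j)
    coord (w_frame zz.2) j (G zz.1 zz.2 (tnth (w_frame zz.1) i)).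

(* ((g, g') . G)(z, z')(v) = g' . G(g^-1 z, g'^-1 z')(g^-1 . v).  The
   projections vsproj are the identity on the vectors to which they are applied,
   because g maps the fibre of W0 at z to the one at g z, see [Wact_W0]. *)
Definition hom_act (g g' : 'M[R]_2) (G : hom_family) : hom_family :=
  fun z z' => linfun (fun v : subvs_of (W0 z) =>
    let z1 := mobius (invmx g) z in
    let z1' := mobius (invmx g') z' in
    vsproj (W0 z')
      (Wact g' (vsval (G z1 z1' (vsproj (W0 z1) (Wact (invmx g) (vsval v))))))).

(* A (continuous) section of Hom(pr_1^* W_0, pr_2^* W_0) over the complement of
   the diagonal in C x C, given by its lifts to the components. *)
Definition is_hom_section (M : nat)
    (s : {unit 'Z_M} -> {unit 'Z_M} -> hom_family) : Prop :=
  forall c c' : {unit 'Z_M},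
    (forall (g g' : Gamma M) (z z' : R[i]), off_diag R c c' (z, z') ->
       hom_act (Gamma_mx R g) (Gamma_mx R g') (s c c') z z' = s c c' z z') /\
    {within off_diag R c c', continuous (hom_mx (s c c'))}.

End Bundle.

Section Facts.
Variables (R : realType) (k t : nat).

Lemma ubasis_homog i : ubasis R i \is ishomog1 1 mdeg.
Proof. by rewrite dhomogX /= mdeg1. Qed.

Lemma linform_homog (z : R[i]) : linform z \is ishomog1 1 mdeg.
Proof. by rewrite rpredD ?rpredZ ?ubasis_homog. Qed.

Lemma sym_actE (g : 'M[R]_2) (P : Sym R k) :
  val (sym_act g P) = sym_subst g (val P).
Proof. by []. Qed.

Lemma hodge_vecE (z : R[i]) (a b : nat) : (a + b = 2 * k - 2)%N ->
  val (hodge_vec k z a b) = linform z ^+ a * linform (conjc z) ^+ b.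
Proof.
move=> e; rewrite /hodge_vec /indhomog insubdK // -e; rewrite -[is_true _]/(is_true (_ \is ishomog1 (a + b) mdeg)).
apply: dhomogM; [rewrite -[X in ishomog1 X]mul1n|rewrite -[X in ishomog1 X]mul1n];
  apply: dhomogMn; exact: linform_homog.
Qed.

Lemma sym_subst_linform (g : 'M[R]_2) (z : R[i]) : autj g z != 0 ->
  sym_subst g (linform z) = autj g z *: linform (mobius g z).
Proof.
move=> j0.
rewrite /sym_subst /linform comp_mpolyD comp_mpolyZ !comp_mpolyXU -!tnth_nth.
rewrite !tnth_mktuple !big_ord_recl !big_ord0 !addr0 /=.
rewrite (_ : lift ord0 ord0 = 1); last exact: val_inj.
rewrite !scalerDr !scalerA /mobius mulrCA divff // mulr1.
rewrite addrACA -!scalerDl /autj; congr (_ *: _ + _ *: _); ring.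
Qed.

Lemma conjc_lin (a b : R) (z : R[i]) :
  conjc (a%:C * z + b%:C) = a%:C * conjc z + b%:C.
Proof. by case: z => x y; apply/eqP; rewrite eq_complex /=; apply/andP; split; apply/eqP; ring. Qed.

Lemma conjc_autj (g : 'M[R]_2) (z : R[i]) : conjc (autj g z) = autj g (conjc z).
Proof. exact: conjc_lin. Qed.

Lemma conjc_mobius (g : 'M[R]_2) (z : R[i]) : conjc (mobius g z) = mobius g (conjc z).
Proof.
rewrite /mobius -conjc_autj -conjc_lin -conjc_inv.
exact: (rmorphM (@conjc R)).
Qed.

Lemma det22 (g : 'M[R]_2) : \det g = g 0 0 * g 1 1 - g 0 1 * g 1 0.
Proof.
rewrite (expand_det_row _ 0) !big_ord_recl big_ord0 /cofactor !det_mx11 !mxE /=.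
rewrite (_ : lift ord0 ord0 = 1); last exact: val_inj.
rewrite (_ : lift 1 0 = 0); last exact: val_inj.
by rewrite expr0 expr1; ring.
Qed.

Lemma autj_neq0 (g : 'M[R]_2) (z : R[i]) :
  0 < complex.Im z -> \det g != 0 -> autj g z != 0.
Proof.
case: z => x y /= y0; rewrite det22; apply: contra.
rewrite /autj eq_complex /=.
rewrite !mul0r !(addr0, subr0) => /andP[/eqP h /eqP h2].
have g10 : g 1 0 = 0 by apply/eqP; move/eqP: h2; rewrite mulf_eq0 (gt_eqF y0) orbF.
by move: h; rewrite g10 mul0r add0r => ->; rewrite !mulr0 subrr.
Qed.

Lemma sym_act_hodge (g : 'M[R]_2) (z : R[i]) (a b : int) :
  0 < complex.Im z -> \det g != 0 ->
  exists c, sym_act g (hodge_vec k z a b) = c *: hodge_vec k (mobius g z) a b.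
Proof.
move=> z0 dg; have j0 := autj_neq0 z0 dg.
have j0' : autj g (conjc z) != 0 by rewrite -conjc_autj conjc_eq0.
have s0 : sym_act g (0 : Sym R k) = 0.
  by apply: val_inj; rewrite sym_actE /= /sym_subst comp_mpoly0.
case: a b => [a|a] [b|b]; try by exists 0; rewrite /= s0 scale0r.
case: (eqVneq (a + b)%N (2 * k - 2)%N) => [e|ne]; last first.
  exists 0; rewrite scale0r; suff -> : hodge_vec k z a b = 0 by [].
  have h : linform z ^+ a * linform (conjc z) ^+ b \is ishomog1 (a + b) mdeg.
    by apply: dhomogM; [rewrite -[X in ishomog1 X]mul1n|rewrite -[X in ishomog1 X]mul1n];
      apply: dhomogMn; exact: linform_homog.
  rewrite /hodge_vec /indhomog /insubd; case: insubP => //= u hu eu.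
  case: (eqVneq (linform z ^+ a * linform (conjc z) ^+ b) 0) => [e0|n0].
    by apply: val_inj; rewrite /= eu e0.
  by case/eqP: ne; apply: (dhomog_uniq n0 h hu).
exists (autj g z ^+ a * autj g (conjc z) ^+ b).
apply: val_inj; rewrite sym_actE hodge_vecE // linearZ/= [X in _ *: X](hodge_vecE _ e).
rewrite /sym_subst rmorphM !rmorphXn/= -!/(sym_subst _ _) !sym_subst_linform //.
by rewrite !exprZn conjc_mobius -scalerAl -scalerAr scalerA.
Qed.

Lemma sym_actZ (g : 'M[R]_2) (a : R[i]) (P : Sym R k) :
  sym_act g (a *: P) = a *: sym_act g P.
Proof.
apply: val_inj; rewrite [LHS]sym_actE [LHS]/sym_subst.
transitivity (a *: val (sym_act g P)); last by [].
by rewrite sym_actE /sym_subst -comp_mpolyZ.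
Qed.

Lemma sym_actD (g : 'M[R]_2) (P Q : Sym R k) :
  sym_act g (P + Q) = sym_act g P + sym_act g Q.
Proof.
apply: val_inj; rewrite [LHS]sym_actE [LHS]/sym_subst.
transitivity (val (sym_act g P) + val (sym_act g Q)); last by [].
by rewrite (sym_actE g P) (sym_actE g Q) /sym_subst; exact: comp_mpolyD.
Qed.

Lemma sym_act0 (g : 'M[R]_2) : sym_act g (0 : Sym R k) = 0.
Proof. by apply: val_inj; rewrite /= /sym_subst comp_mpoly0. Qed.

Lemma Wact_W0 (g : 'M[R]_2) (z : R[i]) (v : Wfibre R k) :
  0 < complex.Im z -> \det g != 0 ->
  v \in W0 k t z -> Wact g v \in W0 k t (mobius g z).
Proof.
move=> z0 dg /memv_addP[_ /vlineP[a ->] [_ /vlineP[b ->] ->]].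
have [c ec] := sym_act_hodge (0 + t%:Z + (k - 1)%N%:Z) (0 - t%:Z + (k - 1)%N%:Z) z0 dg.
have [d ed] := sym_act_hodge (0 - t%:Z + (k - 1)%N%:Z) (0 + t%:Z + (k - 1)%N%:Z) z0 dg.
set x' := hodge_vec k (mobius g z) _ _ in ec.
set y' := hodge_vec k (mobius g z) _ _ in ed.
have -> : Wact g (a *: (hodge_vec k z (0 + t + (k - 1)%N) (0 - t%:Z + (k - 1)%N), 0 : Sym R k)
     + b *: (0 : Sym R k, hodge_vec k z (0 - t%:Z + (k - 1)%N) (0 + t + (k - 1)%N)))
   = (a * c) *: ((x', 0) : Wfibre R k) + (b * d) *: ((0, y') : Wfibre R k).
  rewrite /Wact /=; congr pair; rewrite /= sym_actD !sym_actZ ?ec ?ed ?sym_act0 !scaler0 !scalerA ?addr0 ?add0r //.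
by apply: memv_add; apply: memvZ; exact: memv_line.
Qed.

Lemma W0E (z : R[i]) : W0 k t z =
  (<[((hodge_vec k z ((k - 1)%N%:Z + t%:Z) ((k - 1)%N%:Z - t%:Z), 0%R) : Wfibre R k)]> +
   <[((0%R, hodge_vec k z ((k - 1)%N%:Z - t%:Z) ((k - 1)%N%:Z + t%:Z)) : Wfibre R k)]>)%VS.
Proof.
have e1 : 0 + t%:Z + (k - 1)%N%:Z = (k - 1)%N%:Z + t%:Z by rewrite add0r addrC.
have e2 : 0 - t%:Z + (k - 1)%N%:Z = (k - 1)%N%:Z - t%:Z by rewrite sub0r addrC.
by rewrite /W0 /Whodge e1 e2.
Qed.

Lemma wplus_in (z : R[i]) : wplus k t z \in W0 k t z.
Proof.
rewrite W0E; apply: (subvP (addvSl _ _)); apply/vlineP.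
exists (xi_inv R k t * (complex.Im z ^ (t%:Z - (k - 1)%N%:Z))%:C).
by congr pair; last by rewrite /= scaler0.
Qed.

Lemma wminus_in (z : R[i]) : wminus k t z \in W0 k t z.
Proof.
rewrite W0E; apply: (subvP (addvSr _ _)); apply/vlineP.
exists (xi_inv R k t * (complex.Im z ^ (- (k - 1)%N%:Z - t%:Z))%:C).
by congr pair; first by rewrite /= scaler0.
Qed.

Lemma linform_neq0 (z : R[i]) : linform z != 0.
Proof.
apply/eqP => /(congr1 (mcoeff (mnm1 (1 : 'I_2)))).
rewrite mcoeffD mcoeffZ !mcoeffX mcoeff0 eqxx.
have -> : (mnm1 0 == mnm1 (1 : 'I_2)) = false.
  by apply/eqP => /(congr1 (fun m : multinom 2 => m 0)); rewrite !mnm1E.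
by rewrite mulr0 add0r => /eqP; rewrite oner_eq0.
Qed.

Lemma hodge_vec_neq0 (z : R[i]) (a b : nat) : (a + b = 2 * k - 2)%N ->
  hodge_vec k z a b != 0.
Proof.
move=> e; apply/eqP => /(congr1 val); rewrite hodge_vecE //= => /eqP.
by rewrite mulf_eq0 !expf_eq0 !(negbTE (linform_neq0 _)) !andbF.
Qed.

Lemma xi_inv_neq0 : (t <= k - 1)%N -> xi_inv R k t != 0.
Proof.
move=> tk; rewrite /xi_inv !mulf_neq0 //.
- rewrite eq_complex /= eqxx andbT sqrtr_eq0 -ltNge ltr0n bin_gt0; lia.
- rewrite expf_neq0 ?mulf_neq0 ?pnatr_eq0 //.
    by rewrite eq_complex /= eqxx andbT gt_eqF ?pi_gt0.
  by rewrite eq_complex /= oner_eq0 andbF.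

Qed.

Lemma w_frame_basis (z : R[i]) :
  (t <= k - 1)%N -> 0 < complex.Im z -> basis_of fullv (w_frame k t z).
Proof.
move=> tk z0.
have nz (n : int) : xi_inv R k t * (complex.Im z ^ n)%:C != 0.
  rewrite mulf_neq0 ?xi_inv_neq0 //.
  by rewrite eq_complex /= eqxx andbT expfz_neq0 // gt_eqF.
have e1 : ((k - 1)%N%:Z + t%:Z) = ((k - 1) + t)%N%:Z by [].
have e2 : ((k - 1)%N%:Z - t%:Z) = ((k - 1) - t)%N%:Z by rewrite subzn.
rewrite basisEfree subvf size_tuple /=.
have fr : free (w_frame k t z).
  rewrite free_cons seq1_free; apply/andP; split; last first.
    apply/eqP => /(congr1 vsval); rewrite vsprojK ?wminus_in //= => /(congr1 snd) /= /eqP.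
    rewrite scaler_eq0 (negbTE (nz _)) /= ?e1 e2; apply/negP/hodge_vec_neq0; lia.
  rewrite span_seq1; apply/vlineP => -[c /(congr1 vsval)].
  rewrite linearZ /= !vsprojK ?wminus_in ?wplus_in // => /(congr1 fst) /= /eqP.
  rewrite scaler0 scaler_eq0 (negbTE (nz _)) /= ?e1 e2; apply/negP/hodge_vec_neq0; lia.
rewrite fr /= dimvf /dim /=.
rewrite W0E (leq_trans (dimv_add_leqif _ _)) // !dim_vline.
by case: eqP => _; case: eqP.
Qed.
End Facts.

Section GreenKernel.
Variables (R : realType) (k t : nat).

Definition Qkt (x : R) : R :=
  \int[@lebesgue_measure R]_w
    (2 ^+ (2 * t) /
     ((x + Num.sqrt (x ^+ 2 - 1) * ((expR w + expR (- w)) / 2)) ^+ (k - t) *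
      (x + 1 + Num.sqrt (x ^+ 2 - 1) * expR w) ^+ (2 * t))).

Definition green (z z' : R[i]) : R :=
  - Qkt (1 + (complex.Re (z - z') ^+ 2 + complex.Im (z - z') ^+ 2) /
             (2 * complex.Im z * complex.Im z')).

Definition mu_plus (z z' : R[i]) : R[i] :=
  (green z z')%:C *
    ((z - conjc z') / (2 * 'i * (complex.Im z')%:C)) ^+ (2 * t).

Definition mu_minus (z z' : R[i]) : R[i] :=
  (green z z')%:C *
    ((conjc z - z') / (2 * 'i * (complex.Im z)%:C)) ^+ (2 * t).

(* The section G_g: w^+(z) |-> mu_g^+ w^+(z'), w^-(z) |-> mu_g^- w^-(z'). *)
Definition G_green : hom_family R k t :=
  fun z z' => linfun (fun v : subvs_of (W0 k t z) =>
    (mu_plus z z' * coord (w_frame k t z) 0 v) *: tnth (w_frame k t z') 0 +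
    (mu_minus z z' * coord (w_frame k t z) 1 v) *: tnth (w_frame k t z') 1).

(* Sum of (1, gamma^-1) . G_g over a finite set of gamma in Gamma(M). *)
Definition G_partial (M : nat) (A : {fset Gamma M}) : hom_family R k t :=
  fun z z' => partial_sum
    (fun g : Gamma M => hom_act 1%:M (invmx (Gamma_mx R g)) G_green z z') A.

End GreenKernel.

Arguments G_partial R k t {M} A.

(* Main.v *)
(* On H x H, G_g is diagonal in the frames (w^+, w^-), and so is the sum: its two
   entries are the series over Gamma(M) of j(g, z')^-n F(z, g z') with
   (n, F) = (2t, mu_g^+) or (-2t, mu_g^-).  With X = 1 + |z - w|^2 / (2 y Im w),
   w = g z', a term has absolute value Q_{k,t}(X) (rho (X + 1))^t where
   rho = y / 2y' or y' / 2y, and Q_{k,t}(X) (X + 1)^t = O(X^-2) because t < k.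
   Locally uniformly X dominates the squared Frobenius norm of g, so everything
   follows from sum_g |g|^-4 < oo over SL_2(Z), by the M-test.  Invariance is the
   cocycle relation of j together with the substitution g |-> h g h'^-1. *)
Require Import Defs.
From HB Require Import structures.
From mathcomp Require Import all_boot all_order all_algebra.
From mathcomp Require Import finmap.
From mathcomp Require Import all_classical all_reals all_analysis.
From mathcomp Require Import summability measurable_realfun.
From mathcomp Require Import complex.
From mathcomp Require Import -(notations) mpoly.
From mathcomp Require Import ring lra zify.
Import Order.TTheory GRing.Theory Num.Theory.
Import numFieldNormedType.Exports.
Local Open Scope ring_scope.
Local Open Scope classical_set_scope.
Set Implicit Arguments.
Unset Strict Implicit.
Unset Printing Implicit Defensive.

(** * Topology of the complex numbers *)

(** The number of matrices of norm at most [T] in SL_2(Z) grows like [T^2], so a decay [X^-1] of the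
    terms would be just too weak. The decay [X^-2] has one factor from the [cosh] factor of the
    integrand and one from a power [(X + 1) ^+ t] left over, where [0 < t]. Convergence of the sum
    of [|g|^-4] needs no counting: [g] is coded injectively by three integers, and Lagrange's
    identity bounds [|g|^-4] by a constant times a product of three terms [1 / (1 + n^2)]. The
    obstacle is the singularity of [Qkt] at [X = 1]. Near a given point all but finitely many [g]
    have [X >= 2], so the M-test is stated with a finite exceptional set [J]: two partial sums over
    sets containing [J] differ by dominated terms only, whatever the values on [J]. Sums are
    unconditional, that is, limits along the filter [totally] of finite subsets, so that a bijection
    of Gamma(M) may be substituted freely. Since the fibres [W0 z] vary with [z], the analysis is
    done on the scalar diagonal entries. *)

Lemma cvg_exprn (K : numFieldType) (T : Type) (F : set_system T) (FF : Filter F)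
  (f : T -> K) (a : K) (n : nat) :
  f x @[x --> F] --> a -> f x ^+ n @[x --> F] --> a ^+ n.
Proof.
move=> fa; elim: n => [|n IHn]; first by under eq_cvg do rewrite expr0; exact: cvg_cst.
by under eq_cvg do rewrite exprS; rewrite exprS; exact: cvgM.
Qed.

Lemma cvg_exprz (K : numFieldType) (T : Type) (F : set_system T) (FF : Filter F)
  (f : T -> K) (a : K) (n : int) : a != 0 ->
  f x @[x --> F] --> a -> f x ^ n @[x --> F] --> a ^ n.
Proof.
by case: n => n a0 fa; [|apply: cvgV; first exact: expf_neq0]; exact: cvg_exprn.
Qed.

Section ComplexTopology.
Variable R : realType.
Local Open Scope complex_scope.
Implicit Types (z : R[i]).

Lemma normc_ge_Im z : `|complex.Im z|%:C <= `|z|.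
Proof.
have := normc_ge_Re (z * 'i%C).
by rewrite ReiNIm normrN normrM (normc_def (Complex 0 1)) /= expr0n expr1n add0r sqrtr1 mulr1.
Qed.

Lemma Re_continuous : continuous (@complex.Re R : R[i] -> R).
Proof.
move=> z; have FF := nbhs_filter z; apply/cvgrPdist_lt => e e0.
near=> w; rewrite -raddfB -ltcR; apply: le_lt_trans (normc_ge_Re _) _.
by near: w; apply: cvgr_dist_lt => //; rewrite ltcR.
Unshelve. all: by end_near. Qed.

Lemma Im_continuous : continuous (@complex.Im R : R[i] -> R).
Proof.
move=> z; have FF := nbhs_filter z; apply/cvgrPdist_lt => e e0.
near=> w; rewrite -raddfB -ltcR; apply: le_lt_trans (normc_ge_Im _) _.
by near: w; apply: cvgr_dist_lt => //; rewrite ltcR.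
Unshelve. all: by end_near. Qed.

Lemma gtc0_real (e : R[i]) : 0 < e -> exists2 r : R, 0 < r & e = r%:C.
Proof.
by case: e => a b; rewrite ltcE /= => /andP[/eqP -> a0]; exists a.
Qed.

Lemma normc_real (x : R) : `|x%:C| = `|x|%:C :> R[i].
Proof. by rewrite normc_def /= expr0n addr0 sqrtr_sqr. Qed.

Lemma real_complex_continuous : continuous (real_complex R : R -> R[i]).
Proof.
move=> x; apply/cvgrPdist_lt => _ /gtc0_real[e e0 ->].
near=> y; rewrite -raddfB normc_real ltcR.
by near: y; exact: cvgr_dist_lt.
Unshelve. all: by end_near. Qed.

Lemma conjc_continuous : continuous (@conjc R : R[i] -> R[i]).
Proof.
move=> z; have FF := nbhs_filter z; apply/cvgrPdist_lt => e e0.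
near=> w; rewrite -raddfB normcJ.
by near: w; exact: cvgr_dist_lt.
Unshelve. all: by end_near. Qed.

(** Real and imaginary parts are 1-Lipschitz, hence carry a Cauchy filter to Cauchy filters on the
    complete [R]; the two limits are then recombined. *)
Lemma complex_complete (F : set_system R[i]) : ProperFilter F -> cauchy F -> cvg F.
Proof.
move=> FF Fc.
have reim (f : R[i] -> R) : (forall z w, `|f z - f w|%:C <= `|z - w|) -> cvg (f @ F).
  move=> fl; apply: cauchy_cvg; apply/cauchy_ballP => e e0.
  have /cauchy_ballP /(_ e%:C) := Fc.
  rewrite ltcR => /(_ e0)[[P Q] /= [FP FQ] PQ].
  exists (f @` P, f @` Q) => /=.
    by split; [move: FP|move: FQ]; apply: filterS => z Pz; exists z.
  move=> [_ _] /= [[z Pz <-] [w Qw <-]].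
  by rewrite /ball /= -ltcR; apply: le_lt_trans (fl _ _) (PQ (z, w) _).
have /cvg_ex[a ha] := reim (@complex.Re R) (fun z w =>
  ltac:(rewrite -raddfB; exact: normc_ge_Re)).
have /cvg_ex[b hb] := reim (@complex.Im R) (fun z w =>
  ltac:(rewrite -raddfB; exact: normc_ge_Im)).
apply/cvg_ex; exists (a%:C + 'i%C * b%:C).
rewrite -[F]/(id @ F); rewrite (_ : id = fun z : R[i] => (complex.Re z)%:C + 'i%C * (complex.Im z)%:C); last first.
  by apply/funext => z; exact: complexE.
apply: cvgD.
  apply: continuous_cvg => //; exact: real_complex_continuous.
apply: cvgMr; apply: continuous_cvg => //; exact: real_complex_continuous.
Qed.

End ComplexTopology.

(** * Unconditional sums *)

Section UnconditionalSums.
Variables (R : realType) (I : choiceType).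
Local Open Scope complex_scope.
Local Open Scope fset_scope.
Local Open Scope ring_scope.

Lemma partial_sumE (V : zmodType) (f : I -> V) (A : {fset I}) :
  partial_sum f A = \sum_(i <- A) f i.
Proof. by rewrite /partial_sum big_seq_fsetE. Qed.

Lemma partial_sumD_diff (V : zmodType) (f : I -> V) (A B : {fset I}) :
  (A `<=` B)%fset -> partial_sum f B = partial_sum f A + partial_sum f (B `\` A)%fset.
Proof.
move=> AB; rewrite !partial_sumE (big_fsetID _ (mem A)) /=.
congr (_ + _); apply: eq_fbigl => i; rewrite !inE /=.
  by case: (boolP (i \in A)) => [/(fsubsetP AB) ->|]; rewrite ?andbF.
by rewrite andbC.
Qed.

Section Domination.
Variables (v : I -> R) (S : R).
Hypothesis v_ge0 : forall i, 0 <= v i.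
Hypothesis v_bound : forall A : {fset I}, partial_sum v A <= S.

(** Partial sums of a nonnegative family are monotone: beyond a set [A0] whose sum is within [e] of
    the supremum, no enlargement can gain [e]. *)
Lemma bounded_sums_tail (e : R) : 0 < e ->
  exists A0 : {fset I}, forall A B : {fset I}, (A0 `<=` A)%fset -> (A `<=` B)%fset ->
    partial_sum v (B `\` A)%fset < e.
Proof.
move=> e0; pose E := range (partial_sum v).
have supE : has_sup E.
  by split; [exists (partial_sum v fset0), fset0|exists S => _ [A _ <-]].
have [_ [A0 _ <-] A0e] := sup_adherent e0 supE.
have mono (A B : {fset I}) : (A `<=` B)%fset -> partial_sum v A <= partial_sum v B.
  move=> AB; rewrite (partial_sumD_diff _ AB) lerDl partial_sumE.
  exact: sumr_ge0.
exists A0 => A B A0A AB; have := mono _ _ A0A.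
have : partial_sum v B <= sup E by apply: sup_upper_bound => //; exists B.
rewrite (partial_sumD_diff _ AB); move: A0e; rewrite /E; lra.
Qed.

(** The terms in [J] belong to both sums and cancel, so domination is needed only outside [J]. *)
Lemma dominated_partial_sum (f : I -> R[i]) (J : {fset I}) (e : R) : 0 < e ->
  (forall A B : {fset I}, (J `<=` A)%fset -> (A `<=` B)%fset -> partial_sum v (B `\` A)%fset < e) ->
  (forall i, i \notin J -> `|f i| <= (v i)%:C) ->
  forall A B : {fset I}, (J `<=` A)%fset -> (A `<=` B)%fset ->
    `|partial_sum f A - partial_sum f B| < e%:C.
Proof.
move=> e0 tl fv A B JA AB; rewrite distrC (partial_sumD_diff _ AB) addrAC subrr add0r.
apply: le_lt_trans (_ : _ <= (partial_sum v (B `\` A)%fset)%:C) _; last first.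
  by rewrite ltcR; exact: tl.
rewrite !partial_sumE; apply: le_trans (ler_norm_sum _ _ _) _.
rewrite raddf_sum /= big_seq [leRHS]big_seq; apply: ler_sum => i.
rewrite inE => /andP[iA _]; apply: fv; apply: contra iA; exact: (fsubsetP JA).
Qed.

Lemma dominated_sum_cvg (f : I -> R[i]) (J : {fset I}) :
  (forall i, i \notin J -> `|f i| <= (v i)%:C) ->
  partial_sum f @ totally --> sum f.
Proof.
move=> fv; have FF := @totally_filter I.
apply: complex_complete; apply: cauchy_exP => _ /gtc0_real[e e0 ->].
have [A0 tl] := bounded_sums_tail e0.
exists (partial_sum f (A0 `|` J)%fset); exists (A0 `|` J)%fset => // B JB.
rewrite /= /ball /=; apply: (@dominated_partial_sum _ (A0 `|` J)%fset _ e0) (fsubset_refl _) JB.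
  move=> C D JC CD; apply: tl CD; exact: fsubset_trans (fsubsetUl A0 J) JC.
by move=> i; rewrite inE negb_or => /andP[_ ?]; exact: fv.
Qed.

(** [A0] is built from [v] and [J] alone and hence serves all [q] near [p] at once. The set [B] of
    the proof depends on [q], but it only serves to pass to the limit. *)
Lemma dominated_sum_near (T : topologicalType) (p : T) (f : I -> T -> R[i]) (J : {fset I}) :
  (\forall q \near p, forall i, i \notin J -> `|f i q| <= (v i)%:C) ->
  forall e : R[i], 0 < e -> exists A0 : {fset I},
    \forall q \near p, forall A : {fset I}, (A0 `<=` A)%fset ->
      `|sum (f^~ q) - partial_sum (f^~ q) A| < e.
Proof.
move=> fv _ /gtc0_real[e e0 ->]; have e20 : 0 < e / 2 by rewrite divr_gt0.
have [A0 tl] := bounded_sums_tail e20.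
exists (A0 `|` J)%fset; apply: filterS fv => q fv A JA.
have := @dominated_sum_cvg (f^~ q) J fv.
have FF := @totally_filter I.
move/cvgrPdist_lt => /(_ (e / 2)%:C); rewrite ltcR => /(_ e20)[B _ AB].
have := AB (A `|` B)%fset (fsubsetUr _ _) => h1.
rewrite (splitr e) raddfD /=.
rewrite -(subrKA (partial_sum (f^~ q) (A `|` B)%fset)).
apply: le_lt_trans (ler_normD _ _) _; apply: ltrD => //.
rewrite distrC; apply: (@dominated_partial_sum _ (A0 `|` J)%fset _ e20) (JA) _; last exact: fsubsetUl.
  move=> C D JC CD; apply: tl CD; exact: fsubset_trans (fsubsetUl A0 J) JC.
by move=> i; rewrite inE negb_or => /andP[_ ?]; exact: fv.
Qed.

Lemma dominated_sum_continuous (T : topologicalType) (p : T) (f : I -> T -> R[i]) (J : {fset I}) :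
  (\forall q \near p, forall i, i \notin J -> `|f i q| <= (v i)%:C) ->
  (forall i, f i q @[q --> p] --> f i p) ->
  sum (f^~ q) @[q --> p] --> sum (f^~ p).
Proof.
move=> fv fc; have FF := nbhs_filter p; apply/cvgrPdist_lt => e e0.
have e30 : 0 < e / 3 by rewrite divr_gt0.
have [A0 un] := dominated_sum_near fv e30.
have ct : partial_sum (f^~ q) A0 @[q --> p] --> partial_sum (f^~ p) A0.
  by rewrite /partial_sum; apply: cvg_big => [x|i _]; [exact: add_continuous|exact: fc].
near=> q.
rewrite (_ : sum _ - _ = (sum (f^~ p) - partial_sum (f^~ p) A0) +
  (partial_sum (f^~ p) A0 - partial_sum (f^~ q) A0) -
  (sum (f^~ q) - partial_sum (f^~ q) A0)); last by ring.
rewrite (_ : e = e / 3 + e / 3 + e / 3); last by field.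
apply: le_lt_trans (ler_normB _ _) _; apply: ltrD.
  apply: le_lt_trans (ler_normD _ _) _; apply: ltrD.
    by have := nbhs_singleton un; apply.
  by near: q; move/cvgrPdist_lt : ct; exact.
by near: q; apply: filterS un => q; apply.
Unshelve. all: by end_near. Qed.

End Domination.

(** The image under [phi] of a finite set containing [psi(A)] contains [A], so a bijection respects
    the filter [totally]. *)
Lemma sum_reindex (f : I -> R[i]) (phi psi : I -> I) :
  cancel phi psi -> cancel psi phi -> partial_sum f @ totally --> sum f ->
  sum (f \o phi) = sum f.
Proof.
move=> phiK psiK cf; have FF := @totally_filter I; apply/cvg_lim => //.
move=> P fP; have [A _ AP] := cf _ fP; exists [fset psi i | i in A]%fset => // B AB.
have := AP [fset phi i | i in B]%fset; rewrite /= => {}AP.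
have -> : partial_sum (f \o phi) B = partial_sum f [fset phi i | i in B]%fset.
  by rewrite !partial_sumE big_imfset //= => i j _ _; exact: can_inj phiK _ _.
apply: AP; apply/fsubsetP => i iA; apply/imfsetP; exists (psi i) => //=.
by apply: (fsubsetP AB); rewrite in_imfset.
Qed.

Lemma sumZ (c : R[i]) (f : I -> R[i]) :
  partial_sum f @ totally --> sum f ->
  sum (fun i => c * f i) = c * sum f.
Proof.
move=> cf; have FF := @totally_filter I; apply: cvg_lim; first exact: norm_hausdorff.
rewrite (_ : partial_sum _ = fun A => c * partial_sum f A).
  by apply: (@cvgM _ _ _ _ (fun=> c)); [exact: cvg_cst|exact: cf].
by apply/funext => A; rewrite !partial_sumE mulr_sumr.
Qed.

End UnconditionalSums.

(** * The kernel Q *)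

Section GreenKernelBound.
Variables (R : realType) (k t : nat).
Hypothesis tk : (t < k)%N.
Let mu : {measure set _ -> \bar R} := @lebesgue_measure R.

Let s (x : R) : R := Num.sqrt (x ^+ 2 - 1).
Let q (x w : R) : R := 2 ^+ (2 * t) /
     ((x + s x * ((expR w + expR (- w)) / 2)) ^+ (k - t) *
      (x + 1 + s x * expR w) ^+ (2 * t)).

Lemma integrable_oneDsqrV :
  mu.-integrable [set: R] (fun w : R => ((oneDsqr w)^-1)%:E).
Proof.
have mf : measurable_fun [set: R] (fun w : R => (oneDsqr w)^-1).
  by apply: continuous_measurable_fun => w; exact: continuous_oneDsqrV.
have {}mf : measurable_fun [set: R] (fun w : R => ((oneDsqr w)^-1)%:E).
  exact/measurable_EFinP.
apply/integrableP; split => //; apply/abse_integralP => //=.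
rewrite ge0_symfun_integralT //=.
- rewrite (_ : [set x | _] = `[0, +oo[%classic); last first.
    by apply/seteqP; split => x/=; rewrite in_itv/= andbT.
  by rewrite integral0y_oneDsqr -EFinM /= ltry.
- by move=> w; exact: continuous_oneDsqrV.
- by move=> w /=; rewrite /oneDsqr sqrrN.
Qed.

(** One exponential suffices: [1 + u^2 / 2 <= exp u] for [u = |w|], and the other one is
    positive. *)
Lemma oneDsqr_le_cosh (w : R) : oneDsqr w / 4 <= (expR w + expR (- w)) / 2.
Proof.
have h (u : R) : 0 <= u -> 1 + u ^+ 2 / 2 <= expR u.
  by move=> u0; have := expR_ge1Dxn 1 u0.
rewrite /oneDsqr; have [w0|/ltW w0] := leP 0 w.
  by have := h _ w0; have := expR_ge0 (- w); have := sqr_ge0 w; lra.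
by have := h (- w); rewrite sqrrN oppr_ge0 => /(_ w0); have := expR_ge0 w; have := sqr_ge0 w; lra.
Qed.

Lemma s_gt0 (x : R) : 1 < x -> 0 < s x.
Proof. by move=> x1; rewrite sqrtr_gt0 subr_gt0; nra. Qed.

Lemma q_ge0 (x : R) w : 1 < x -> 0 <= q x w.
Proof.
move=> x1; have s0 := s_gt0 x1; have e0 := expR_gt0 w; have e0' := expR_gt0 (- w).
apply: divr_ge0; first exact: exprn_ge0.
by apply: mulr_ge0; apply: exprn_ge0; nra.
Qed.

(** As [k - t >= 1] and its base is at least 1, the first factor of the denominator is at least
    [s x * cosh w >= s0 * (1 + w^2) / 4]; the second is at least [(x + 1) ^+ (2 * t)]. The separate
    lower bound [s0] lets one integrable majorant serve a whole interval of [x] in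
    [Qkt_continuous]. *)
Lemma q_le s0 (x : R) w : 1 < x -> 0 < s0 -> s0 <= s x ->
  q x w <= 2 ^+ (2 * t) * 4 / ((x + 1) ^+ (2 * t) * s0) * (oneDsqr w)^-1.
Proof.
move=> x1 s00 s0x; have sx := s_gt0 x1; have e0 := expR_gt0 w; have e0' := expR_gt0 (- w).
have o1 := oneDsqr_ge1 w; have oc := oneDsqr_le_cosh w.
set ch := (expR w + expR (- w)) / 2 in oc *.
have X0 : 0 < (x + 1) ^+ (2 * t) by apply: exprn_gt0; lra.
have o0 : 0 < oneDsqr w by lra.
rewrite [leRHS](_ : _ = 2 ^+ (2 * t) / (s0 * (oneDsqr w / 4) * (x + 1) ^+ (2 * t))); last first.
  by field; rewrite !gt_eqF.
rewrite /q -/ch ler_pM2l ?exprn_gt0 // lef_pV2 ?posrE; first last.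
- by rewrite !mulr_gt0 // divr_gt0.
- by apply: mulr_gt0; apply: exprn_gt0; nra.
have A1 : x + s x * ch <= (x + s x * ch) ^+ (k - t).
  have -> : (k - t = (k - t).-1.+1)%N by lia.
  by rewrite exprS ler_peMr ?exprn_ege1 //; nra.
have A2 : (x + 1) ^+ (2 * t) <= (x + 1 + s x * expR w) ^+ (2 * t).
  by apply: lerXn2r; rewrite ?nnegrE; nra.
apply: ler_pM => //.
- by apply: mulr_ge0; lra.
- exact: ltW.
- apply: le_trans A1; have : s0 * (oneDsqr w / 4) <= s x * ch by apply: ler_pM => //; lra.
  lra.
Qed.

Lemma q_measurable (x : R) : 1 < x -> measurable_fun [set: R] (fun w => (q x w)%:E).
Proof.
move=> x1; apply/measurable_EFinP; apply: continuous_measurable_fun => w.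
have sx := s_gt0 x1; have e0 := expR_gt0 w; have e0' := expR_gt0 (- w).
have ce : expR v @[v --> w] --> expR w by exact: continuous_expR.
have ce' : expR (- v) @[v --> w] --> expR (- w).
  by apply: (continuous_comp (@oppr_continuous _ _ w)); exact: continuous_expR.
apply: cvgM; first exact: cvg_cst.
apply: cvgV; first by rewrite mulf_neq0 // expf_neq0 // gt_eqF //; nra.
apply: cvgM; apply: cvg_exprn; apply: cvgD; try exact: cvg_cst.
  apply: cvgM; first exact: cvg_cst.
  by apply: cvgM; [exact: cvgD|exact: cvg_cst].
by apply: cvgM => //; exact: cvg_cst.
Qed.

Lemma q_integrable (x : R) : 1 < x -> mu.-integrable [set: R] (fun w => (q x w)%:E).
Proof.
move=> x1; have sx := s_gt0 x1.
apply: (le_integrable _ _ _ (integrableZl _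
  (2 ^+ (2 * t) * 4 / ((x + 1) ^+ (2 * t) * s x)) integrable_oneDsqrV)) => //.
  exact: q_measurable.
move=> w _; rewrite -EFinM !abse_EFin lee_fin ger0_norm ?q_ge0 //.
by apply: le_trans (ler_norm _); exact: q_le.
Qed.

Lemma Qkt_ge0 (x : R) : 1 < x -> 0 <= Qkt k t x.
Proof. by move=> x1; apply: Rintegral_ge0 => w _; exact: q_ge0. Qed.

Lemma Qkt_le (x : R) : 1 < x ->
  Qkt k t x <= 2 ^+ (2 * t) * 4 / ((x + 1) ^+ (2 * t) * s x) *
    \int[mu]_w (oneDsqr w)^-1.
Proof.
move=> x1; have sx := s_gt0 x1.
rewrite -RintegralZl //; last exact: integrable_oneDsqrV.
apply: le_Rintegral => //; first exact: q_integrable.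
  by apply: (integrableZl _ _ integrable_oneDsqrV).
by move=> w _; exact: q_le.
Qed.

(** Of the [2 * t] powers of [x + 1] in [Qkt_le], [t] cancel and the others, as [t >= 1], contribute
    a factor at least [x]; the second factor comes from [s x >= x / 2]. *)
Lemma Qkt_decay : (0 < t)%N -> exists2 C : R, 0 < C &
  forall x, 2 <= x -> Qkt k t x * (x + 1) ^+ t <= C / x ^+ 2.
Proof.
move=> t0; set J := \int[mu]_w (oneDsqr w)^-1.
have J0 : 0 <= J.
  by apply: Rintegral_ge0 => w _; rewrite invr_ge0 (le_trans ler01) // oneDsqr_ge1.
(* The 8 is the 4 of [Qkt_le] divided by the 1/2 of [x / 2 <= s x]. Adding 1 makes the constant
   positive, since [J] is only shown to be nonnegative. *)
exists (2 ^+ (2 * t) * 8 * J + 1); first by rewrite ltr_wpDl // !mulr_ge0 // exprn_ge0.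
move=> x x2; have x1 : 1 < x by lra.
have sx : x / 2 <= s x.
  have -> : x / 2 = Num.sqrt ((x / 2) ^+ 2) by rewrite sqrtr_sqr ger0_norm //; lra.
  by apply: ler_wsqrtr; nra.
have X0 : 0 < (x + 1) ^+ t by apply: exprn_gt0; lra.
have X1 : x <= (x + 1) ^+ t.
  have -> : (t = t.-1.+1)%N by lia.
  rewrite exprS; have := exprn_ege1 t.-1 (_ : 1 <= x + 1); nra.
apply: le_trans (_ : 2 ^+ (2 * t) * 8 * J / x ^+ 2 <= _); last first.
  by rewrite ler_pM2r ?invr_gt0 ?exprn_gt0; lra.
have := Qkt_le x1; rewrite -/J.
have -> : (x + 1) ^+ (2 * t) = (x + 1) ^+ t * (x + 1) ^+ t by rewrite mul2n -addnn exprD.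
move=> QJ; set P := 2 ^+ (2 * t) in QJ *; have P0 : 0 < P by apply: exprn_gt0.
have -> : P * 8 * J / x ^+ 2 = P * 4 * J / (x * (x / 2)) by field; lra.
apply: le_trans (_ : P * 4 / ((x + 1) ^+ t * (x + 1) ^+ t * s x) * J * (x + 1) ^+ t <= _).
  by rewrite ler_pM2r.
have -> : P * 4 / ((x + 1) ^+ t * (x + 1) ^+ t * s x) * J * (x + 1) ^+ t
   = P * 4 * J / ((x + 1) ^+ t * s x) by field; rewrite !gt_eqF //; lra.
apply: ler_wpM2l; first by rewrite !mulr_ge0 // ltW.
rewrite lef_pV2 ?posrE; [by apply: ler_pM; lra| |]; nra.
Qed.

Lemma Qkt_continuous (x : R) : 1 < x -> {for x, continuous (Qkt k t)}.
Proof.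
(* The window []u, v[] keeps away from 1, where [s] vanishes, so [s u] bounds [s] from below on
   it. *)
move=> x1; pose u := (1 + x) / 2; pose v := x + 1.
have u1 : 1 < u by rewrite /u; lra.
have Iu y : `]u, v[%classic y -> 1 < y by rewrite /= in_itv /= => /andP[]; lra.
have su := s_gt0 u1.
pose C : R := 2 ^+ (2 * t) * 4 / s u.
apply: (@continuity_under_integral _ _ _ mu q setT measurableT u v _ _
  (fun w => C * (oneDsqr w)^-1)) => //.
- by move=> y /Iu y1; exact: q_integrable.
- apply: aeW => w _ y /set_mem /Iu y1.
  have sy := s_gt0 y1; have e0 := expR_gt0 w; have e0' := expR_gt0 (- w).
  have cs : s z @[z --> y] --> s y.
    rewrite /s; apply: continuous_cvg; first exact: sqrt_continuous.
    by apply: cvgB; [exact: exprn_continuous|exact: cvg_cst].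
  apply: cvgM; first exact: cvg_cst.
  apply: cvgV; first by rewrite mulf_neq0 // expf_neq0 // gt_eqF //; nra.
  apply: cvgM; apply: cvg_exprn; apply: cvgD.
  + exact: cvg_id.
  + by apply: cvgM => //; exact: cvg_cst.
  + by apply: cvgD; [exact: cvg_id|exact: cvg_cst].
  + by apply: cvgM => //; exact: cvg_cst.
- by apply: (integrableZl _ C integrable_oneDsqrV).
- move=> y Iy; apply: aeW => w _; have y1 := Iu _ Iy.
  rewrite ger0_norm ?q_ge0 //.
  have suy : s u <= s y.
    apply: ler_wsqrtr; move: Iy; rewrite /= in_itv /= => /andP[uy _]; nra.
  apply: le_trans (q_le w y1 su suy) _; apply: ler_wpM2r.
    by rewrite invr_ge0 (le_trans ler01) // oneDsqr_ge1.
  rewrite /C ler_pM2l ?mulr_gt0 ?exprn_gt0 // lef_pV2 ?posrE //.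
    by apply: ler_peMl; [exact: ltW|apply: exprn_ege1; lra].
  by apply: mulr_gt0 => //; apply: exprn_gt0; lra.
- by rewrite inE /= in_itv /= /u /v; apply/andP; split; lra.
Qed.

End GreenKernelBound.

(** * Sums over lattices *)

Section LatticeSums.
Variable R : realType.

Lemma sumr_sub_uniq (T : eqType) (s1 s2 : seq T) (F : T -> R) :
  uniq s1 -> {subset s1 <= s2} -> (forall x, 0 <= F x) ->
  \sum_(x <- s1) F x <= \sum_(x <- s2) F x.
Proof.
move=> u1 s12 F0.
suff [r pr] : exists r, perm_eq s2 (s1 ++ r).
  by rewrite (perm_big _ pr) big_cat /= lerDl; apply: sumr_ge0.
elim: s1 s2 u1 s12 => [|x s1 IHs] s2 /=; first by exists s2.
move=> /andP[xs1 u1] sub; have xs2 : x \in s2 by apply: sub; exact: mem_head.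
have [|r pr] := IHs (rem x s2) u1.
  move=> y ys1; have ys2 : y \in s2 by apply: sub; rewrite inE ys1 orbT.
  move: ys2; rewrite (perm_mem (perm_to_rem xs2)) inE => /orP[/eqP yx|//].
  by rewrite yx (negbTE xs1) in ys1.
by exists r; rewrite (permPl (perm_to_rem xs2)) perm_cons.
Qed.

(** A finite set of pairs lies in the product of its two projections, over which the sum factors. *)
Lemma sumr_pair_le (I J : eqType) (u : I -> R) (w : J -> R) (a b : R) :
  (forall i, 0 <= u i) -> (forall j, 0 <= w j) ->
  (forall s, uniq s -> \sum_(i <- s) u i <= a) ->
  (forall s, uniq s -> \sum_(j <- s) w j <= b) ->
  forall s : seq (I * J), uniq s -> \sum_(x <- s) u x.1 * w x.2 <= a * b.
Proof.
move=> u0 w0 ua wb s us.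
pose s1 := undup (map fst s); pose s2 := undup (map snd s).
apply: le_trans (_ : _ <= \sum_(x <- [seq (i, j) | i <- s1, j <- s2]) u x.1 * w x.2) _.
  apply: sumr_sub_uniq => [//|x xs|x]; last exact: mulr_ge0.
  by apply/allpairsP; exists x; rewrite !mem_undup !map_f //; case: (x).
rewrite big_allpairs /=.
under eq_bigr do rewrite -mulr_sumr.
rewrite -mulr_suml; apply: ler_pM.
- exact: sumr_ge0.
- exact: sumr_ge0.
- exact/ua/undup_uniq.
- exact/wb/undup_uniq.
Qed.

Lemma sumr_inj_le (I J : eqType) (f : I -> J) (u : J -> R) (a : R) :
  injective f -> (forall s, uniq s -> \sum_(j <- s) u j <= a) ->
  forall s, uniq s -> \sum_(i <- s) u (f i) <= a.
Proof.
by move=> fI ua s us; rewrite -(big_map f xpredT) ua // map_inj_uniq.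
Qed.

Lemma sum_inv_oneDsqr_nat (s : seq nat) : uniq s ->
  \sum_(i <- s) (1 + i%:R ^+ 2)^-1 <= 3 :> R.
Proof.
have pos (i : nat) : 0 <= (1 + i%:R ^+ 2)^-1 :> R.
  by rewrite invr_ge0 addr_ge0 // sqr_ge0.
move=> us; pose N := (\max_(i <- s) i)%N.
apply: le_trans (_ : _ <= \sum_(0 <= i < N.+1) (1 + i%:R ^+ 2)^-1) _.
  apply: sumr_sub_uniq => // i ins.
  by rewrite mem_index_iota /= ltnS; apply: leq_bigmax_seq.
(* Telescoping: [1 / (1 + m^2) <= 2 / m - 2 / (m + 1)] for [m >= 1], and the term at 0 is
   [1 = 3 - 2]. *)
have h n : \sum_(0 <= i < n.+1) (1 + i%:R ^+ 2)^-1 <= 3 - 2 / n.+1%:R :> R.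
  elim: n => [|n IHn]; first by rewrite big_nat1 expr0n /= addr0; lra.
  rewrite big_nat_recr //=; apply: le_trans (lerD IHn (lexx _)) _.
  have n0 : 0 <= n%:R :> R by exact: ler0n.
  rewrite -(natr1 n.+1) -(natr1 n); set x := n%:R in n0 *.
  have -> : 3 - 2 / (x + 1 + 1) = 3 - 2 / (x + 1) + 2 / ((x + 1) * (x + 1 + 1)).
    by field; rewrite !gt_eqF //; lra.
  rewrite lerD2l -[2 / _]invf_div lef_pV2 ?posrE; [|nra|].
    by rewrite ler_pdivrMr //; nra.
  by apply: divr_gt0 => //; nra.
by apply: le_trans (h N) _; rewrite gerBl divr_ge0.
Qed.

Lemma sum_inv_oneDsqr_int (s : seq int) : uniq s ->
  \sum_(i <- s) (1 + i%:~R ^+ 2)^-1 <= 6 :> R.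
Proof.
move=> us; have -> : 6 = 3 * 2 :> R by rewrite -natrM.
(* An integer is coded by its absolute value and its sign; the weight depends on the former only,
   and the two signs double the bound 3. *)
pose f (i : int) := (absz i, 0 <= i).
pose u (x : nat * bool) : R := (1 + x.1%:R ^+ 2)^-1 * (fun=> 1) x.2.
rewrite (eq_bigr (u \o f)); last first.
  by move=> [n|n] _; rewrite /= /u /= mulr1 // NegzE mulrNz sqrrN.
apply: (sumr_inj_le (f := f) (u := u)) us.
  by move=> i j [] ij; case: i j ij => i [] j /=; lia.
apply: (sumr_pair_le (u := fun i : nat => (1 + i%:R ^+ 2)^-1) (w := fun=> 1)) => //.
- exact: sum_inv_oneDsqr_nat.
- move=> r ur; rewrite big_const_seq iter_addr_0 count_predT -[1 *+ _]/(_%:R) ler_nat.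
  by have := uniq_leq_size ur (s2 := [:: true; false]); apply => -[].
Qed.

End LatticeSums.

(** * The sum of the inverse fourth powers of the norms over SL_2(Z) *)

Section ModularSums.
Variable R : realType.

Definition frob (g : 'M[R]_2) : R :=
  g 0 0 ^+ 2 + g 0 1 ^+ 2 + (g 1 0 ^+ 2 + g 1 1 ^+ 2).

(* The three integers determine [g] when [\det g = 1]: the lower row, and the
   rounded component of the upper row along the lower one. *)
Definition row_code (g : 'M[int]_2) : int * (int * int) :=
  (divz (g 0 0 * g 1 0 + g 0 1 * g 1 1) (g 1 0 ^+ 2 + g 1 1 ^+ 2), (g 1 0, g 1 1)).

Lemma ord2_cases (i : 'I_2) : i = 0 \/ i = 1.
Proof. by case: i => [[|[|]]] // ?; [left|right]; apply: val_inj. Qed.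

Lemma det_int22 (g : 'M[int]_2) : \det g = g 0 0 * g 1 1 - g 0 1 * g 1 0.
Proof.
apply: (intr_inj (R := R)); rewrite -[LHS]/(intmul _ _) -det_map_mx det22 !mxE.
by rewrite rmorphB !rmorphM.
Qed.

Lemma lower_row_gt0 (a b c d : int) : a * d - b * c = 1 -> 0 < c ^+ 2 + d ^+ 2.
Proof.
move=> dg; rewrite lt_def addr_ge0 ?sqr_ge0 // andbT paddr_eq0 ?sqr_ge0 // !sqrf_eq0.
by apply/negP => /andP[/eqP c0 /eqP d0]; move: dg; rewrite c0 d0 !mulr0.
Qed.

(** Two matrices of determinant 1 with the same lower row [(c, d)] have upper rows differing by a
    multiple [k (c, d)]. The inner products of upper and lower row then differ by [k s] with
    [s = c^2 + d^2]; if their quotients by [s] agree, [k s] is a difference of two remainders, so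
    [k = 0]. *)
Lemma row_code_inj (g h : 'M[int]_2) : \det g = 1 -> \det h = 1 ->
  row_code g = row_code h -> g = h.
Proof.
rewrite !det_int22 /row_code => dg dh [+ c10 c11].
rewrite -c10 -c11 in dh *; move: dg dh.
set a := g 0 0; set b := g 0 1; set a' := h 0 0; set b' := h 0 1.
set c := g 1 0; set d := g 1 1; set s := c ^+ 2 + d ^+ 2 => dg dh en.
have s0 : 0 < s by exact: (lower_row_gt0 dg).
(* Bezout: multiply [a - a'] and [b - b'] by [1 = a * d - b * c] and use [e0], the difference of the
   two determinant equations. *)
pose k := (a - a') * (- b) + a * (b - b').
have e0 : (a - a') * d = (b - b') * c by lia.
have ep : a - a' = k * c.
  by rewrite -[LHS]mulr1 -dg /k; transitivity (a * ((a - a') * d) - (a - a') * b * c); [|rewrite e0]; ring.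
have eq : b - b' = k * d.
  by rewrite -[LHS]mulr1 -dg /k; transitivity (a * d * (b - b') - b * ((b - b') * c)); [|rewrite -e0]; ring.
have ek : (a * c + b * d) - (a' * c + b' * d) = k * s.
  rewrite (_ : _ - _ = (a - a') * c + (b - b') * d); last by ring.
  by rewrite ep eq /s; ring.
have := divz_eq (a * c + b * d) s; have := divz_eq (a' * c + b' * d) s.
rewrite -/a -/b en.
have := modz_ge0 (a * c + b * d) (lt0r_neq0 s0).
have := modz_ge0 (a' * c + b' * d) (lt0r_neq0 s0).
have := ltz_pmod (a * c + b * d) s0; have := ltz_pmod (a' * c + b' * d) s0.
move: (modz (a' * c + _) s) (modz (a * c + _) s) (divz _ _) => r2 r1 n l2 l1 g2 g1 m2 m1.
have ks : k * s = r1 - r2 by rewrite -ek m1 m2; ring.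
have k1 : k < 1 by rewrite -(ltr_pM2r s0) ks; lia.
have k2 : -1 < k by rewrite -(ltr_pM2r s0) ks; lia.
have k0 : k = 0 by lia.
move: ep eq; rewrite k0 !mul0r => /subr0_eq ea /subr0_eq eb.
apply/matrixP => i j; by have [->|->] := ord2_cases i; have [->|->] := ord2_cases j.
Qed.

(** [P] and [S] are the squared norms of the upper and the lower row, [M] is their inner product and
    [N] the rounding of [M / S]. Lagrange's identity [P S = M^2 + 1] turns the bound on [N S] into
    [N^2 S <= 2 (P + S)], so [(1 + N^2) S <= 3 (P + S)], while [(1 + C^2) (1 + D^2) <= 4 S^2]; hence
    [36 = 4 * 3^2]. *)
Lemma code_bound (P S C D N M : R) : 1 <= S -> S = C ^+ 2 + D ^+ 2 ->
  P * S = M ^+ 2 + 1 -> (N * S) ^+ 2 <= 2 * M ^+ 2 + 2 * S ^+ 2 ->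
  (1 + N ^+ 2) * ((1 + C ^+ 2) * (1 + D ^+ 2)) <= 36 * (P + S) ^+ 2.
Proof.
move=> S1 SE PS NS.
have [C0 D0 N0] : [/\ 0 <= C ^+ 2, 0 <= D ^+ 2 & 0 <= N ^+ 2] by rewrite !sqr_ge0.
have M0 := sqr_ge0 M; have P0 : 0 <= P by nra.
set n := N ^+ 2 in N0 *.
have h : n * S <= 2 * P + 2 * S.
  rewrite -(ler_pM2r (lt_le_trans ltr01 S1)).
  have -> : n * S * S = (N * S) ^+ 2 by rewrite /n; ring.
  apply: le_trans NS _; have -> : (2 * P + 2 * S) * S = 2 * (P * S) + 2 * S ^+ 2 by ring.
  rewrite PS; lra.
have h2 : (1 + n) * S <= 3 * (P + S) by lra.
have h3 : (1 + C ^+ 2) * (1 + D ^+ 2) <= (2 * S) * (2 * S) by apply: ler_pM; lra.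
have h4 : ((1 + n) * S) ^+ 2 <= (3 * (P + S)) ^+ 2.
  by rewrite ler_sqr ?nnegrE //; nra.
apply: le_trans (_ : (1 + n) * ((2 * S) * (2 * S)) <= _).
  by apply: ler_wpM2l => //; lra.
rewrite !exprMn in h4.
have h5 : (1 + n) * S ^+ 2 <= (1 + n) ^+ 2 * S ^+ 2.
  by apply: ler_wpM2r; [exact: sqr_ge0|nra].
have -> : (1 + n) * ((2 * S) * (2 * S)) = 4 * ((1 + n) * S ^+ 2) by ring.
lra.
Qed.

(** [frob] is the squared norm, so its inverse square is [|g|^-4]; inverting [code_bound] splits it
    over the three integers of the code. *)
Lemma frob_row_code (g : 'M[int]_2) (x := row_code g) : \det g = 1 ->
  0 < frob (intmx R g) /\
  ((frob (intmx R g))^-1) ^+ 2 <= 36 * ((1 + x.1%:~R ^+ 2)^-1 *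
    ((1 + x.2.1%:~R ^+ 2)^-1 * (1 + x.2.2%:~R ^+ 2)^-1)).
Proof.
rewrite det_int22 /x /row_code /frob !mxE /= => dg.
move: dg; set a := g 0 0; set b := g 0 1; set c := g 1 0; set d := g 1 1 => dg.
set m := a * c + b * d; set s := c ^+ 2 + d ^+ 2.
have s0 : 0 < s by exact: (lower_row_gt0 dg).
have := divz_eq m s; have := modz_ge0 m (lt0r_neq0 s0); have := ltz_pmod m s0.
set n := divz m s; set r := modz m s => rs r0 mE.
have lag : (a ^+ 2 + b ^+ 2) * s = m ^+ 2 + 1.
  by rewrite -[1](expr1n _ 2) -dg /s /m; ring.
have ns : (n * s) ^+ 2 <= 2 * m ^+ 2 + 2 * s ^+ 2.
  have -> : n * s = m - r by rewrite mE; ring.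
  have : r ^+ 2 <= s ^+ 2 by rewrite ler_sqr ?nnegrE // ltW.
  have -> : (m - r) ^+ 2 = 2 * m ^+ 2 + 2 * r ^+ 2 - (m + r) ^+ 2 by ring.
  by move: (sqr_ge0 (m + r)) => h1 h2; rewrite lerBlDr -addrA lerD2l ler_wpDr // ler_wpM2l.
have s1R : 1 <= s%:~R :> R by rewrite ler1z.
have sR : s%:~R = c%:~R ^+ 2 + d%:~R ^+ 2 :> R by rewrite rmorphD !rmorphXn.
have lagR : (a%:~R ^+ 2 + b%:~R ^+ 2) * s%:~R = m%:~R ^+ 2 + 1 :> R.
  by rewrite -!rmorphXn -rmorphD -rmorphM lag rmorphD.
have nsR : (n%:~R * s%:~R) ^+ 2 <= 2 * m%:~R ^+ 2 + 2 * s%:~R ^+ 2 :> R.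
  rewrite -rmorphM -!rmorphXn -[2]/(2%:~R) -!rmorphM -rmorphD ler_int; exact: ns.
have f0 : 0 < a%:~R ^+ 2 + b%:~R ^+ 2 + (c%:~R ^+ 2 + d%:~R ^+ 2) :> R.
  by rewrite -sR ltr_wpDl ?addr_ge0 ?sqr_ge0 //; lra.
split=> //; have := code_bound s1R sR lagR nsR.
have p (y : R) : 0 < 1 + y ^+ 2 by rewrite ltr_pwDl ?sqr_ge0.
rewrite -sR -!invfM exprVn -[36 / _]invf_div lef_pV2 ?posrE.
- by rewrite ler_pdivrMr // [leRHS]mulrC.
- by rewrite exprn_gt0 // sR.
- by rewrite divr_gt0 // !mulr_gt0.
Qed.

Lemma Gamma_det M (g : Gamma M) : \det (val g) = 1.
Proof. by case: g => g /= /andP[/eqP]. Qed.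

Lemma frob_gt0 M (g : Gamma M) : 0 < frob (Gamma_mx R g).
Proof. by have [] := frob_row_code (Gamma_det g). Qed.

Lemma frob_sum_le M (A : {fset Gamma M}) :
  partial_sum (fun g => ((frob (Gamma_mx R g))^-1) ^+ 2) A <= 36 * (6 * (6 * 6)).
Proof.
pose w (i : int) : R := (1 + i%:~R ^+ 2)^-1.
have w0 i : 0 <= w i by rewrite invr_ge0 addr_ge0 // sqr_ge0.
pose u (x : int * (int * int)) := w x.1 * (w x.2.1 * w x.2.2).
rewrite partial_sumE.
apply: le_trans (_ : \sum_(g <- A) 36 * u (row_code (val g)) <= _).
  by apply: ler_sum => g _; have [] := frob_row_code (Gamma_det g).
rewrite -mulr_sumr ler_pM2l //.
apply: (sumr_inj_le (f := fun g : Gamma M => row_code (val g))); last exact: fset_uniq.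
  by move=> g h /(row_code_inj (Gamma_det g) (Gamma_det h)) /val_inj.
have w6 s : uniq s -> \sum_(i <- s) w i <= 6 by exact: sum_inv_oneDsqr_int.
have ww s : uniq s -> \sum_(x <- s) w x.1 * w x.2 <= 6 * 6.
  exact: (sumr_pair_le w0 w0 w6 w6).
apply: (sumr_pair_le (w := fun x => w x.1 * w x.2) w0 _ w6 ww) => x.
exact: mulr_ge0.
Qed.

End ModularSums.

(** * Geometry of the upper half plane *)

Section HalfPlaneGeometry.
Variable R : realType.
Local Open Scope complex_scope.
Implicit Types (z w : R[i]) (g h : 'M[R]_2).

(** The squared modulus as an element of [R]; the norm on [R[i]] has its values in [R[i]]. *)
Definition nsq z : R := complex.Re z ^+ 2 + complex.Im z ^+ 2.

Lemma nsqE z : (nsq z)%:C = `|z| ^+ 2.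
Proof. exact: add_Re2_Im2. Qed.

Lemma nsqM z w : nsq (z * w) = nsq z * nsq w.
Proof. by apply: complexI; rewrite rmorphM /= !nsqE normrM exprMn. Qed.

Lemma nsqV z : nsq z^-1 = (nsq z)^-1.
Proof. by apply: complexI; rewrite fmorphV /= !nsqE normfV exprVn. Qed.

Lemma nsqJ z : nsq (conjc z) = nsq z.
Proof. by apply: complexI; rewrite !nsqE normcJ. Qed.

Lemma nsq_gt0 z : z != 0 -> 0 < nsq z.
Proof. by move=> z0; rewrite -ltcR nsqE exprn_gt0 ?normr_gt0. Qed.

Lemma nsq_real (x : R) : nsq x%:C = x ^+ 2.
Proof. by rewrite /nsq /= expr0n addr0. Qed.

(** The hyperbolic cosine of the distance from [z] to [w], which is the argument of [Qkt] in
    [green]. *)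
Definition point_pair z w : R := 1 + nsq (z - w) / (2 * complex.Im z * complex.Im w).

(** This rests on [|z - conj w|^2 = |z - w|^2 + 4 Im z Im w], and measures the factors of [mu_plus]
    and [mu_minus] by [X + 1]. *)
Lemma nsq_subJ z w : 0 < complex.Im z -> 0 < complex.Im w ->
  nsq (z - conjc w) = 2 * complex.Im z * complex.Im w * (point_pair z w + 1).
Proof.
case: z w => [x y] [u v]; rewrite /point_pair /nsq /= => y0 v0; field.
by rewrite !gt_eqF.
Qed.

Lemma mobius_num g z : autj g z != 0 ->
  (g 0 0)%:C * z + (g 0 1)%:C = mobius g z * autj g z.
Proof. by move=> j0; rewrite divfK. Qed.

Lemma mulmx22 (A B : 'M[R]_2) i j : (A *m B) i j = A i 0 * B 0 j + A i 1 * B 1 j.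
Proof.
rewrite !mxE !big_ord_recl big_ord0 addr0 /=.
by rewrite (_ : lift ord0 ord0 = 1) //; exact: val_inj.
Qed.

Lemma autjM g h z : autj h z != 0 -> autj (g *m h) z = autj g (mobius h z) * autj h z.
Proof.
move=> j0; rewrite [in RHS]/autj mulrDl -mulrA -mobius_num // /autj !mulmx22.
by rewrite !(rmorphD, rmorphM) /=; ring.
Qed.

Lemma mobiusM g h z : autj h z != 0 -> mobius (g *m h) z = mobius g (mobius h z).
Proof.
move=> j0; rewrite [LHS]/mobius autjM //.
have -> : ((g *m h) 0 0)%:C * z + ((g *m h) 0 1)%:C =
    ((g 0 0)%:C * mobius h z + (g 0 1)%:C) * autj h z.
  rewrite mulrDl -mulrA -mobius_num // /autj !mulmx22 !(rmorphD, rmorphM) /=; ring.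
by rewrite -mulf_div divff // mulr1.
Qed.

Lemma mobiusB g z w : autj g z != 0 -> autj g w != 0 ->
  mobius g z - mobius g w = (\det g)%:C * (z - w) / (autj g z * autj g w).
Proof.
rewrite /mobius det22 !(rmorphB, rmorphM) /= /autj => jz jw.
by field; rewrite jz jw.
Qed.

Lemma Im_mobius g z : \det g = 1 -> 0 < complex.Im z ->
  complex.Im (mobius g z) = complex.Im z / nsq (autj g z).
Proof.
move=> dg z0; have jz : autj g z != 0 by rewrite autj_neq0 // dg oner_eq0.
have jz' : autj g (conjc z) != 0 by rewrite -conjc_autj conjc_eq0.
apply: complexI; rewrite fmorph_div /= nsqE sqr_normc.
have := mobiusB jz jz'; rewrite dg -conjc_mobius !subcJ mul1r -conjc_autj => e.
apply: (mulfI (_ : 2%:R * 'i%C != 0 :> R[i])); last first.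
  by rewrite mulrAC e [RHS]mulrA; congr (_ / _); rewrite mulrAC.
by rewrite mulf_neq0 ?pnatr_eq0 // eq_complex /= oner_eq0 andbF.
Qed.

Lemma Im_mobius_gt0 g z : \det g = 1 -> 0 < complex.Im z -> 0 < complex.Im (mobius g z).
Proof.
move=> dg z0; rewrite Im_mobius // divr_gt0 // nsq_gt0 //.
by rewrite autj_neq0 // dg oner_eq0.
Qed.

Lemma point_pair_mobius g z w : \det g = 1 -> 0 < complex.Im z -> 0 < complex.Im w ->
  point_pair (mobius g z) (mobius g w) = point_pair z w.
Proof.
move=> dg z0 w0.
have [jz jw] : autj g z != 0 /\ autj g w != 0 by rewrite !autj_neq0 // dg oner_eq0.
rewrite /point_pair mobiusB // dg mul1r !Im_mobius // !(nsqM, nsqV).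
have := nsq_gt0 jz; have := nsq_gt0 jw => n1 n2.
by field; rewrite !gt_eqF.
Qed.

End HalfPlaneGeometry.

(** * The Frobenius norm of a matrix against hyperbolic distance *)

Section GreenTerms.
Variable R : realType.
Local Open Scope complex_scope.
Implicit Types (z w : R[i]) (g h : 'M[R]_2).

(** The linear map [(u, v) |-> (u x - v, u y)] is inverted: [u^2 <= (u y)^2 / d^2] and
    [v = u x - (u x - v)]. *)
Lemma sqr_shear_bound (x y u v B d : R) : 0 < d -> x ^+ 2 <= B ^+ 2 -> d <= y ->
  u ^+ 2 + v ^+ 2 <= (2 + (1 + 2 * B ^+ 2) / d ^+ 2) * ((u * x - v) ^+ 2 + (u * y) ^+ 2).
Proof.
move=> d0 xB dy; have d20 : 0 < d ^+ 2 by apply: exprn_gt0.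
set F1 := (u * x - v) ^+ 2; set F2 := (u * y) ^+ 2.
have [F10 F20] : 0 <= F1 /\ 0 <= F2 by rewrite !sqr_ge0.
have B20 := sqr_ge0 B; have u20 := sqr_ge0 u.
have uF : (1 + 2 * B ^+ 2) * u ^+ 2 <= (1 + 2 * B ^+ 2) / d ^+ 2 * F2.
  rewrite -mulrA; apply: ler_wpM2l; first by lra.
  by rewrite ler_pdivlMl // mulrC /F2 exprMn ler_wpM2l // ler_sqr ?nnegrE //; lra.
have vF : v ^+ 2 <= 2 * F1 + 2 * (u ^+ 2 * B ^+ 2).
  have h1 : u ^+ 2 * x ^+ 2 <= u ^+ 2 * B ^+ 2 by apply: ler_wpM2l.
  have h2 : 0 <= (2 * (u * x) - v) ^+ 2 by exact: sqr_ge0.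
  by rewrite /F1; move: h1 h2; rewrite -exprMn !expr2; nra.
have : 0 <= (1 + 2 * B ^+ 2) / d ^+ 2 * F1.
  by rewrite mulr_ge0 // divr_ge0 // ltW; lra.
move: uF; set k := (1 + 2 * B ^+ 2) / d ^+ 2 => uF kF.
have -> : (2 + k) * (F1 + F2) = 2 * F1 + 2 * F2 + k * F1 + k * F2 by ring.
lra.
Qed.

(** A form of [2 cosh d(i, g i) = |g|^2], with [z] and [w] moved to [i] by upper triangular
    matrices: up to the factor [Im z * Im w], the right side is the squared Frobenius norm of the
    transported matrix. In the computation a cross term, a multiple of [\det g], cancels against the
    1 in [point_pair]. *)
Lemma point_pair_mobiusE g z w : \det g = 1 -> 0 < complex.Im z -> 0 < complex.Im w ->
  let u1 := complex.Re z * g 1 0 - g 0 0 in let v1 := g 0 1 - complex.Re z * g 1 1 in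
  let u2 := complex.Im z * g 1 0 in let v2 := - (complex.Im z * g 1 1) in
  point_pair z (mobius g w) * (2 * complex.Im z * complex.Im w) =
    ((u1 * complex.Re w - v1) ^+ 2 + (u1 * complex.Im w) ^+ 2) +
    ((u2 * complex.Re w - v2) ^+ 2 + (u2 * complex.Im w) ^+ 2).
Proof.
move=> dg z0 w0 u1 v1 u2 v2.
have jw : autj g w != 0 by rewrite autj_neq0 // dg oner_eq0.
have n0 := nsq_gt0 jw.
have e : nsq (z - mobius g w) * nsq (autj g w) =
    nsq (z * autj g w - ((g 0 0)%:C * w + (g 0 1)%:C)).
  by rewrite -nsqM mulrBl -mobius_num.
have -> : point_pair z (mobius g w) * (2 * complex.Im z * complex.Im w) =
   2 * complex.Im z * complex.Im w * \det g +
   nsq (z * autj g w - ((g 0 0)%:C * w + (g 0 1)%:C)).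
  by rewrite -e /point_pair Im_mobius // dg; field; rewrite !gt_eqF.
rewrite det22 /u1 /u2 /v1 /v2 /nsq /autj; case: (z) (w) => [x y] [x' y'] /=; ring.
Qed.

(** [sqr_shear_bound] is used twice, with [z] on the two columns of [g] and with [w] on [(u1, v1)]
    and [(u2, v2)], whence [K * K]; the rest of the constant bounds [2 * Im z * Im w]. *)
Lemma frob_le_point_pair (B d : R) : 0 < d -> 0 < B -> exists2 C : R, 0 < C &
  forall g z w, \det g = 1 ->
    `|complex.Re z| <= B -> d <= complex.Im z <= B ->
    `|complex.Re w| <= B -> d <= complex.Im w <= B ->
    frob g <= C * point_pair z (mobius g w).
Proof.
move=> d0 B0; pose K := 2 + (1 + 2 * B ^+ 2) / d ^+ 2.
have K0 : 0 < K.
  by rewrite ltr_wpDr // divr_ge0 ?sqr_ge0 //; have := sqr_ge0 B; lra.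
exists (K * K * (2 * (B * B))); first by rewrite !mulr_gt0.
move=> g z w dg xB /andP[dy yB] uB /andP[dv vB].
have z0 : 0 < complex.Im z by lra.
have w0 : 0 < complex.Im w by lra.
have sq (x : R) : `|x| <= B -> x ^+ 2 <= B ^+ 2.
  by move=> xB'; rewrite -real_normK ?num_real // ler_sqr ?nnegrE // ltW.
have := point_pair_mobiusE dg z0 w0.
set u1 := _ - g 0 0; set v1 := g 0 1 - _; set u2 := _ * g 1 0; set v2 := - _.
set X := point_pair _ _ => /= XE.
have h1 := sqr_shear_bound u1 v1 d0 (sq _ uB) dv.
have h2 := sqr_shear_bound u2 v2 d0 (sq _ uB) dv.
have h3 := sqr_shear_bound (g 1 0) (g 0 0) d0 (sq _ xB) dy.
have h4 := sqr_shear_bound (g 1 1) (g 0 1) d0 (sq _ xB) dy.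
rewrite -/K in h1 h2 h3 h4.
have f1 : frob g <= K * ((u1 ^+ 2 + v1 ^+ 2) + (u2 ^+ 2 + v2 ^+ 2)).
  move: (lerD h3 h4); rewrite -mulrDr /frob => h; apply: le_trans (le_trans h _); first lra.
  by rewrite le_eqVlt; apply/orP; left; apply/eqP; rewrite /u1 /u2 /v1 /v2; ring.
have f2 : K * ((u1 ^+ 2 + v1 ^+ 2) + (u2 ^+ 2 + v2 ^+ 2)) <=
    K * (K * (X * (2 * complex.Im z * complex.Im w))).
  by rewrite ler_pM2l // XE mulrDr; exact: lerD.
apply: le_trans f1 (le_trans f2 _).
have X0 : 0 <= X.
  rewrite -(pmulr_lge0 _ (_ : 0 < 2 * complex.Im z * complex.Im w)) ?mulr_gt0 //.
  by rewrite XE !addr_ge0 ?sqr_ge0.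
rewrite (_ : K * K * _ * X = K * (K * (X * (2 * (B * B))))); last by ring.
rewrite ler_pM2l // ler_pM2l //; apply: ler_wpM2l => //.
by rewrite -mulrA ler_pM2l //; apply: ler_pM; lra.
Qed.

End GreenTerms.

(** * Terms of the series *)

Section GreenTerms.
Variables (R : realType) (k t : nat).
Local Open Scope complex_scope.
Implicit Types (z w : R[i]) (g h : 'M[R]_2).
Local Notation kernel := (R[i] -> R[i] -> R[i]).

Definition equivariant (n : int) (F : kernel) : Prop :=
  forall g z w, \det g = 1 -> 0 < complex.Im z -> 0 < complex.Im w ->
    F (mobius g z) (mobius g w) = F z w * (autj g w / autj g z) ^ n.

Definition green_term (n : int) (F : kernel) g (p : R[i] * R[i]) : R[i] :=
  autj g p.2 ^ (- n) * F p.1 (mobius g p.2).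

Lemma green_mobius g z w : \det g = 1 -> 0 < complex.Im z -> 0 < complex.Im w ->
  green k t (mobius g z) (mobius g w) = green k t z w.
Proof.
move=> dg z0 w0; have := point_pair_mobius dg z0 w0.
by rewrite /green /point_pair /nsq => ->.
Qed.

Lemma Im_mobiusC g z : \det g = 1 -> 0 < complex.Im z ->
  (complex.Im (mobius g z))%:C = (complex.Im z)%:C / (autj g z * conjc (autj g z)).
Proof. by move=> dg z0; rewrite Im_mobius // fmorph_div /= nsqE sqr_normc. Qed.

Lemma neq0_Im z : 0 < complex.Im z -> (complex.Im z)%:C != 0 :> R[i].
Proof. by move=> z0; rewrite eq_complex /= eqxx andbT gt_eqF. Qed.

Lemma neq0_2i : 2 * 'i != 0 :> R[i].
Proof. by rewrite mulf_neq0 ?pnatr_eq0 // eq_complex /= oner_eq0 andbF. Qed.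

(** In [(z - conj w) / Im w] the factors [j(g, conj w)] of numerator and denominator cancel, and
    [j(g, w) / j(g, z)] is left. *)
Lemma mu_plus_equivariant : equivariant (2 * t)%N (@mu_plus R k t).
Proof.
move=> g z w dg z0 w0.
have [jz jw] : autj g z != 0 /\ autj g w != 0 by rewrite !autj_neq0 // dg oner_eq0.
have jw' : autj g (conjc w) != 0 by rewrite -conjc_autj conjc_eq0.
rewrite -exprnP /mu_plus green_mobius // -[RHS]mulrA -exprMn conjc_mobius mobiusB // dg mul1r.
rewrite Im_mobiusC // conjc_autj; congr (_ * _ ^+ _).
have := neq0_Im w0; have := neq0_2i; move: (2 * 'i) => c c0 w0'.
by field; rewrite c0 w0' jw jz jw'.
Qed.

Lemma mu_minus_equivariant : equivariant (- (2 * t)%N%:Z) (@mu_minus R k t).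
Proof.
move=> g z w dg z0 w0.
have [jz jw] : autj g z != 0 /\ autj g w != 0 by rewrite !autj_neq0 // dg oner_eq0.
have jz' : autj g (conjc z) != 0 by rewrite -conjc_autj conjc_eq0.
rewrite -exprz_inv -exprnP /mu_minus green_mobius // -[RHS]mulrA -exprMn conjc_mobius mobiusB // dg mul1r.
rewrite Im_mobiusC // conjc_autj; congr (_ * _ ^+ _).
have := neq0_Im z0; have := neq0_2i; move: (2 * 'i) => c c0 z0'.
by field; rewrite c0 z0' jw jz jz'.
Qed.

(** By the relation between the four matrices, [g (h' w) = h (gam w)], and the cocycle relation
    expresses [j(g, h' w)] by [j(h, gam w)], whose powers cancel against those produced by [eF]. *)
Lemma green_term_mobius n F g h h' gam z w : equivariant n F ->
  \det g = 1 -> \det h = 1 -> \det h' = 1 -> \det gam = 1 -> h *m gam = g *m h' ->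
  0 < complex.Im z -> 0 < complex.Im w ->
  green_term n F g (mobius h z, mobius h' w) =
    autj h z ^ (- n) * autj h' w ^ n * green_term n F gam (z, w).
Proof.
move=> eF dg dh dh' dgam e z0 w0; rewrite /green_term /=.
have nz (m : 'M[R]_2) (u : R[i]) : \det m = 1 -> 0 < complex.Im u -> autj m u != 0.
  by move=> dm u0; rewrite autj_neq0 // dm oner_eq0.
have w1 := Im_mobius_gt0 dgam w0; have w2 := Im_mobius_gt0 dh' w0.
have eq2 : mobius g (mobius h' w) = mobius h (mobius gam w).
  by rewrite -!mobiusM ?nz // e.
have ej : autj g (mobius h' w) = autj h (mobius gam w) * autj gam w / autj h' w.
  by rewrite -!autjM ?nz // e autjM ?nz // mulfK ?nz.
rewrite eq2 eF // ej !expfzMl !exprz_inv opprK -!invr_expz.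
have := nz _ _ dh w1; have := nz _ _ dh z0; have := nz _ _ dh' w0; have := nz _ _ dgam w0.
move=> /(expfz_neq0 n) n1 /(expfz_neq0 n) n2 /(expfz_neq0 n) n3 /(expfz_neq0 n) n4.
move: n1 n2 n3 n4; move: (autj gam w ^ n) (autj h' w ^ n) (autj h z ^ n) => a b c.
move: (_ ^ n) (F _ _) => d f a0 b0 c0 d0.
by field; rewrite a0 c0 d0.
Qed.


(** [B / d] bounds the ratio of imaginary parts. [Qkt] appears in absolute value because [X = 1] is
    allowed here, while its sign is established for [X > 1]. *)
Definition green_bounded (n : int) (F : kernel) : Prop :=
  forall (B d : R) g z w, \det g = 1 -> 0 < d ->
    d <= complex.Im z <= B -> d <= complex.Im w <= B ->
    `|green_term n F g (z, w)| <=
      (`|Qkt k t (point_pair z (mobius g w))| *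
       ((B / d) ^+ t * (point_pair z (mobius g w) + 1) ^+ t))%:C.

Lemma greenE z w : green k t z w = - Qkt k t (point_pair z w).
Proof. by []. Qed.

Lemma norm_exp2 z (n : nat) : `|z ^+ (2 * n)| = (nsq z ^+ n)%:C.
Proof. by rewrite normrX exprM -nsqE rmorphXn. Qed.

Lemma nsq_2i : nsq (2 * 'i : R[i]) = 4.
Proof.
rewrite nsqM (_ : nsq 'i = 1); last by rewrite /nsq /= expr0n expr1n add0r.
by rewrite (_ : 2 = (2 : R)%:C) ?nsq_real ?rmorph_nat //; ring.
Qed.

Lemma ratio_le (B d y y' : R) : 0 < d -> d <= y <= B -> d <= y' <= B ->
  0 <= y / (2 * y') <= B / d.
Proof.
move=> d0 /andP[dy yB] /andP[dy' y'B]; apply/andP; split.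
  by rewrite divr_ge0 ?mulr_ge0 //; lra.
rewrite ler_pdivrMr; last lra.
rewrite mulrAC ler_pdivlMr //; apply: ler_pM; lra.
Qed.

Lemma point_pair_ge1 z w : 0 < complex.Im z -> 0 < complex.Im w -> 1 <= point_pair z w.
Proof.
by move=> z0 w0; rewrite lerDl divr_ge0 // ?addr_ge0 ?sqr_ge0 // !mulr_ge0 // ltW.
Qed.

Lemma green_bounded_of (n : int) (F : kernel) (rho : R -> R -> R) :
  (forall (B d y y' : R), 0 < d -> d <= y <= B -> d <= y' <= B -> 0 <= rho y y' <= B / d) ->
  (forall g z w, \det g = 1 -> 0 < complex.Im z -> 0 < complex.Im w ->
    exists2 r, green_term n F g (z, w) = (green k t z (mobius g w))%:C * r ^+ (2 * t) &
      nsq r = rho (complex.Im z) (complex.Im w) * (point_pair z (mobius g w) + 1)) ->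
  green_bounded n F.
Proof.
move=> hrho hr B d g z w dg d0 zB wB.
have z0 : 0 < complex.Im z by case/andP: zB => /(lt_le_trans d0).
have w0 : 0 < complex.Im w by case/andP: wB => /(lt_le_trans d0).
set X := point_pair z (mobius g w).
have X1 : 1 <= X by apply: point_pair_ge1 => //; exact: Im_mobius_gt0.
have [s -> sE] := hr g z w dg z0 w0.
rewrite normrM norm_exp2 normc_real -rmorphM lecR greenE normrN sE.
have /andP[r0 rB] := hrho _ _ _ _ d0 zB wB.
have X0 : 0 <= X + 1 by lra.
apply: ler_wpM2l => //; rewrite -exprMn; apply: lerXn2r; rewrite ?nnegrE.
- exact: mulr_ge0.
- exact: mulr_ge0 (le_trans r0 rB) X0.
- exact: ler_wpM2r.
Qed.

Lemma mu_plus_bounded : green_bounded (2 * t)%N (@mu_plus R k t).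
Proof.
apply: (@green_bounded_of _ _ (fun y y' => y / (2 * y'))); first exact: ratio_le.
move=> g z w dg z0 w0; have gw0 := Im_mobius_gt0 dg w0.
have jw : autj g w != 0 by rewrite autj_neq0 // dg oner_eq0.
(* The automorphy factor goes into [r]: by [Im (g w) = Im w / |j|^2] it turns [Im (g w)] back into
   [Im w], so that [nsq r] depends on [g] only through [X]. *)
exists ((z - conjc (mobius g w)) / (2 * 'i * (complex.Im (mobius g w))%:C) / autj g w).
  by rewrite /green_term /mu_plus /= -exprz_inv -exprnP [in RHS]exprMn [LHS]mulrC -[LHS]mulrA.
rewrite !(nsqM, nsqV) -nsqM nsq_2i nsq_real nsq_subJ //.
have := nsq_gt0 jw; rewrite Im_mobius // => n0.
by field; rewrite !gt_eqF.
Qed.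

Lemma mu_minus_bounded : green_bounded (- (2 * t)%N%:Z) (@mu_minus R k t).
Proof.
apply: (@green_bounded_of _ _ (fun y y' => y' / (2 * y))).
  by move=> B d y y' d0 hy hy'; exact: ratio_le.
move=> g z w dg z0 w0; have gw0 := Im_mobius_gt0 dg w0.
have jw : autj g w != 0 by rewrite autj_neq0 // dg oner_eq0.
exists ((conjc z - mobius g w) / (2 * 'i * (complex.Im z)%:C) * autj g w).
  by rewrite /green_term /mu_minus /= opprK -exprnP [in RHS]exprMn [LHS]mulrC -[LHS]mulrA.
rewrite -[conjc z - _]conjcK rmorphB /= conjcK.
rewrite !(nsqM, nsqV) -nsqM nsq_2i nsq_real nsqJ nsq_subJ //.
have := nsq_gt0 jw; rewrite Im_mobius // => n0.
by field; rewrite !gt_eqF.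
Qed.

End GreenTerms.

(** * Continuity and local domination of the terms *)

Section GreenTermAnalysis.
Variables (R : realType) (k t : nat).
Hypotheses (t0 : (0 < t)%N) (tk : (t < k)%N).
Local Open Scope complex_scope.
Implicit Types (z w : R[i]) (g h : 'M[R]_2).
Local Notation kernel := (R[i] -> R[i] -> R[i]).

Definition off_diag_continuous (F : kernel) : Prop :=
  forall z w, 0 < complex.Im z -> 0 < complex.Im w -> z <> w ->
    F q.1 q.2 @[q --> (z, w)] --> F z w.

Section Cvg.
Context (T : Type) (G : set_system T) {FG : Filter G}.

Lemma cvg_Re (f : T -> R[i]) z : f x @[x --> G] --> z ->
  complex.Re (f x) @[x --> G] --> complex.Re z.
Proof. by move=> fz; apply: continuous_cvg fz; exact: Re_continuous. Qed.

Lemma cvg_Im (f : T -> R[i]) z : f x @[x --> G] --> z ->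
  complex.Im (f x) @[x --> G] --> complex.Im z.
Proof. by move=> fz; apply: continuous_cvg fz; exact: Im_continuous. Qed.

Lemma cvg_conjc (f : T -> R[i]) z : f x @[x --> G] --> z ->
  conjc (f x) @[x --> G] --> conjc z.
Proof. by move=> fz; apply: continuous_cvg fz; exact: conjc_continuous. Qed.

Lemma cvg_real_complex (f : T -> R) (x : R) : f y @[y --> G] --> x ->
  (f y)%:C @[y --> G] --> x%:C.
Proof. by move=> fx; apply: continuous_cvg fx; exact: real_complex_continuous. Qed.

Lemma cvg_affine (a b : R[i]) (f : T -> R[i]) z : f x @[x --> G] --> z ->
  a * f x + b @[x --> G] --> a * z + b.
Proof.
move=> fz; apply: cvgD; last exact: cvg_cst.
by apply: cvgM; [exact: cvg_cst|exact: fz].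
Qed.

Lemma cvg_autj g (f : T -> R[i]) z : f x @[x --> G] --> z ->
  autj g (f x) @[x --> G] --> autj g z.
Proof. exact: cvg_affine. Qed.

Lemma cvg_mobius g (f : T -> R[i]) z : autj g z != 0 -> f x @[x --> G] --> z ->
  mobius g (f x) @[x --> G] --> mobius g z.
Proof.
move=> jz fz; apply: cvgM; first by apply: cvg_affine; exact: fz.
apply: cvgV; [exact: jz|(apply: cvg_autj; exact: fz)].
Qed.
End Cvg.

Lemma point_pair_gt1 z w : 0 < complex.Im z -> 0 < complex.Im w -> z <> w ->
  1 < point_pair z w.
Proof.
move=> z0 w0 zw; rewrite ltrDl divr_gt0 ?mulr_gt0 //.
by apply: nsq_gt0; rewrite subr_eq0; exact/eqP.
Qed.

Lemma cvg_green z w : 0 < complex.Im z -> 0 < complex.Im w -> z <> w ->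
  (green k t q.1 q.2)%:C @[q --> (z, w)] --> (green k t z w)%:C.
Proof.
move=> z0 w0 zw; have c1 : q.1 @[q --> (z, w)] --> z by exact: cvg_fst.
have c2 : q.2 @[q --> (z, w)] --> w by exact: cvg_snd.
apply: cvg_real_complex; apply: cvgN.
apply: continuous_cvg; first exact: (Qkt_continuous tk (point_pair_gt1 z0 w0 zw)).
have c12 := cvgB c1 c2.
apply: cvgD; first exact: cvg_cst.
apply: cvgM; first by apply: cvgD; apply: cvg_exprn; [(apply: cvg_Re; exact: c12)|(apply: cvg_Im; exact: c12)].
apply: cvgV; first by rewrite !mulf_neq0 // gt_eqF.
by apply: cvgM; [apply: cvgM; [exact: cvg_cst|(apply: cvg_Im; exact: c1)]|(apply: cvg_Im; exact: c2)].
Qed.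

Lemma mu_plus_continuous : off_diag_continuous (@mu_plus R k t).
Proof.
move=> z w z0 w0 zw; have c1 : q.1 @[q --> (z, w)] --> z by exact: cvg_fst.
have c2 : q.2 @[q --> (z, w)] --> w by exact: cvg_snd.
apply: cvgM; first exact: (cvg_green z0 w0 zw).
apply: cvg_exprn; apply: cvgM; first by apply: cvgB; [exact: c1|(apply: cvg_conjc; exact: c2)].
apply: cvgV; first by rewrite mulf_neq0 ?neq0_2i ?neq0_Im.
by apply: cvgM; [exact: cvg_cst|apply: cvg_real_complex; (apply: cvg_Im; exact: c2)].
Qed.

Lemma mu_minus_continuous : off_diag_continuous (@mu_minus R k t).
Proof.
move=> z w z0 w0 zw; have c1 : q.1 @[q --> (z, w)] --> z by exact: cvg_fst.
have c2 : q.2 @[q --> (z, w)] --> w by exact: cvg_snd.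
apply: cvgM; first exact: (cvg_green z0 w0 zw).
apply: cvg_exprn; apply: cvgM; first by apply: cvgB; [(apply: cvg_conjc; exact: c1)|exact: c2].
apply: cvgV; first by rewrite mulf_neq0 ?neq0_2i ?neq0_Im.
by apply: cvgM; [exact: cvg_cst|apply: cvg_real_complex; (apply: cvg_Im; exact: c1)].
Qed.

Lemma green_term_continuous (n : int) (F : kernel) g z w : off_diag_continuous F ->
  \det g = 1 -> 0 < complex.Im z -> 0 < complex.Im w -> z <> mobius g w ->
  green_term n F g q @[q --> (z, w)] --> green_term n F g (z, w).
Proof.
move=> cF dg z0 w0 zw; have c1 : q.1 @[q --> (z, w)] --> z by exact: cvg_fst.
have c2 : q.2 @[q --> (z, w)] --> w by exact: cvg_snd.
have jw : autj g w != 0 by rewrite autj_neq0 // dg oner_eq0.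
apply: cvgM; first by apply: cvg_exprz; [exact: jw|(apply: cvg_autj; exact: c2)].
have cm : mobius g q.2 @[q --> (z, w)] --> mobius g w.
  by apply: cvg_mobius; [exact: jw|exact: c2].
exact: (cvg_comp2 (h := F) c1 cm (cF _ _ z0 (Im_mobius_gt0 dg w0) zw)).
Qed.

Lemma Gamma_mx_det M (g : Gamma M) : \det (Gamma_mx R g) = 1.
Proof. by rewrite /Gamma_mx /intmx det_map_mx Gamma_det. Qed.

Lemma green_term_dominated (n : int) (F : kernel) M z w : green_bounded k t n F ->
  0 < complex.Im z -> 0 < complex.Im w ->
  exists C : R, exists J : {fset Gamma M}, 0 <= C /\
    \forall q \near (z, w), forall g : Gamma M, g \notin J ->
      `|green_term n F (Gamma_mx R g) q| <= (C * (frob (Gamma_mx R g))^-1 ^+ 2)%:C.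
Proof.
move=> bF z0 w0.
(* [d] and [B] satisfy strict inequalities at [(z, w)], so that the box they describe is a
   neighbourhood. *)
pose d := Num.min (complex.Im z) (complex.Im w) / 2.
have dm : 0 < Num.min (complex.Im z) (complex.Im w) by rewrite lt_min z0.
have d0 : 0 < d by rewrite divr_gt0.
have [dz dw] : d < complex.Im z /\ d < complex.Im w.
  have : d < Num.min (complex.Im z) (complex.Im w) by rewrite /d; lra.
  by rewrite lt_min => /andP.
pose B := `|complex.Re z| + `|complex.Re w| + complex.Im z + complex.Im w.
have [rz rw] : 0 <= `|complex.Re z| /\ 0 <= `|complex.Re w| by rewrite !normr_ge0.
have [Bz Bw Bz' Bw'] : [/\ `|complex.Re z| < B, `|complex.Re w| < B,
   complex.Im z < B & complex.Im w < B] by split; rewrite /B; lra.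
have B0 : 0 < B by lra.
have [C1 C10 fC] := frob_le_point_pair d0 B0.
have [C2 C20 QC] := Qkt_decay R tk t0.
(* A term outside [J] is a tail below this threshold, so [frob > 2 * C1] and thus [X >= 2]: it is
   away from the singularity and in the range of [Qkt_decay]. *)
have e0 : 0 < ((2 * C1)^-1) ^+ 2 by rewrite exprn_gt0 // invr_gt0 mulr_gt0.
have v0 (g : Gamma M) : 0 <= ((frob (Gamma_mx R g))^-1) ^+ 2 by exact: sqr_ge0.
have [J tl] := bounded_sums_tail v0 (@frob_sum_le R M) e0.
have Bd0 : 0 <= (B / d) ^+ t by rewrite exprn_ge0 // divr_ge0 // ltW.
(* The constant collects the ratio bound, the decay constant [C2], and [X^-2 <= C1^2 / frob^2]. *)
exists ((B / d) ^+ t * (C2 * C1 ^+ 2)), J; split.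
  by rewrite mulr_ge0 // mulr_ge0 ?sqr_ge0 // ltW.
have c1 : q.1 @[q --> (z, w)] --> z by exact: cvg_fst.
have c2 : q.2 @[q --> (z, w)] --> w by exact: cvg_snd.
have r1 := cvg_Re c1; have r2 := cvg_Re c2.
have i1 := cvg_Im c1; have i2 := cvg_Im c2.
near=> q => g gJ.
have [q1 q2] : `|complex.Re q.1| <= B /\ `|complex.Re q.2| <= B.
  split; apply: ltW; near: q.
    by move: Bz; apply: cvgr_lt; apply: cvg_norm; exact: r1.
  by move: Bw; apply: cvgr_lt; apply: cvg_norm; exact: r2.
have q3 : d <= complex.Im q.1 <= B.
  apply/andP; split; apply: ltW; near: q; first by move: dz; apply: cvgr_gt; exact: i1.
  by move: Bz'; apply: cvgr_lt; exact: i1.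
have q4 : d <= complex.Im q.2 <= B.
  apply/andP; split; apply: ltW; near: q; first by move: dw; apply: cvgr_gt; exact: i2.
  by move: Bw'; apply: cvgr_lt; exact: i2.
have dg := Gamma_mx_det g; have f0 := frob_gt0 R g.
have := bF _ _ _ _ _ dg d0 q3 q4; rewrite -surjective_pairing => /le_trans; apply.
rewrite lecR; have := fC _ _ _ dg q1 q3 q2 q4.
set X := point_pair _ _ => fX.
have fC1 : 2 * C1 < frob (Gamma_mx R g).
  have : ((frob (Gamma_mx R g))^-1) ^+ 2 < ((2 * C1)^-1) ^+ 2.
    have := tl J (g |` J)%fset (fsubset_refl _) (fsubsetU1 _ _).
    rewrite partial_sumE (_ : (_ `\` J)%fset = [fset g]%fset) ?big_seq_fset1 //.
    by rewrite fsetDUl fsetDv fsetU0; apply/fsetDidPl; rewrite fdisjoint1X.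
  by rewrite ltr_sqr ?nnegrE ?invr_ge0 ?ltW ?mulr_gt0 // ltf_pV2 ?posrE ?mulr_gt0.
have X2 : 2 <= X by rewrite -(ler_pM2l C10) mulrC; apply: ltW; exact: lt_le_trans fX.
have X0 : 0 < X by exact: lt_le_trans X2.
rewrite ger0_norm; last by apply: Qkt_ge0; apply: lt_le_trans X2; rewrite ltr1n.
rewrite mulrCA -mulrA; apply: ler_wpM2l => //.
apply: le_trans (QC _ X2) _; rewrite -mulrA ler_pM2l //.
rewrite -exprVn -exprMn; apply: lerXn2r; rewrite ?nnegrE.
- by rewrite invr_ge0 ltW.
- by rewrite mulr_ge0 ?invr_ge0 ?ltW.
- by rewrite ler_pdivlMr // mulrC ler_pdivrMr.
Unshelve. all: by end_near. Qed.

End GreenTermAnalysis.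

(** * Diagonal families of homomorphisms *)

Section HomFamilies.
Variables (R : realType) (k t : nat).
Hypothesis tk : (t <= k - 1)%N.
Local Open Scope complex_scope.
Implicit Types (z w : R[i]) (g h : 'M[R]_2).
Local Notation kernel := (R[i] -> R[i] -> R[i]).
Local Notation p := (k - 1)%N (only parsing).

(** [linfun] accepts any function but agrees with it only if it is linear, so its uses in [hom_act]
    and [diag_hom] need justification. *)
Lemma linfun_linearE (K : fieldType) (aT rT : vectType K) (f : aT -> rT) :
  linear f -> linfun f =1 f.
Proof.
move=> lf; pose m := GRing.isLinear.Build _ _ _ _ f lf.
pose fl : {linear aT -> rT} := HB.pack f m.
exact: (lfunE fl).
Qed.

Lemma sym_act_hodge_vec g z (a b : nat) : \det g = 1 -> 0 < complex.Im z ->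
  (a + b = 2 * k - 2)%N ->
  sym_act g (hodge_vec k z a b) =
    (autj g z ^+ a * autj g (conjc z) ^+ b) *: hodge_vec k (mobius g z) a b.
Proof.
move=> dg z0 e; have j0 : autj g z != 0 by rewrite autj_neq0 // dg oner_eq0.
have j0' : autj g (conjc z) != 0 by rewrite -conjc_autj conjc_eq0.
apply: val_inj; rewrite sym_actE hodge_vecE // linearZ/= [X in _ *: X](hodge_vecE _ e).
rewrite /sym_subst rmorphM !rmorphXn/= -!/(sym_subst _ _) !sym_subst_linform //.
by rewrite !exprZn conjc_mobius -scalerAl -scalerAr scalerA.
Qed.

(** Since [Im (g z) = Im z / |j|^2], the power [Im z ^ (- b)] absorbs the [b] conjugate factors and
    leaves the weight [a - b]; for [w^+] and [w^-] this is [2t] and [-2t]. *)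
Lemma sym_act_weight (c : R[i]) g z (a b : nat) : \det g = 1 -> 0 < complex.Im z ->
  (a + b = 2 * k - 2)%N ->
  sym_act g ((c * (complex.Im z ^ (- b%:Z))%:C) *: hodge_vec k z a b) =
  autj g z ^ (a%:Z - b%:Z) *:
    ((c * (complex.Im (mobius g z) ^ (- b%:Z))%:C) *: hodge_vec k (mobius g z) a b).
Proof.
move=> dg z0 e; have j0 : autj g z != 0 by rewrite autj_neq0 // dg oner_eq0.
have j0' : autj g (conjc z) != 0 by rewrite -conjc_autj conjc_eq0.
rewrite sym_actZ sym_act_hodge_vec // !scalerA; congr (_ *: _).
rewrite -!invr_expz -!exprnP !fmorphV !rmorphXn /= Im_mobiusC //.
rewrite expfzDr // -invr_expz -!exprnP !expr_div_n exprMn conjc_autj.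
have y0 : (complex.Im z)%:C ^+ b != 0 :> R[i] by rewrite expf_neq0 // neq0_Im.
have jb : autj g z ^+ b != 0 by rewrite expf_neq0.
have jb' : autj g (conjc z) ^+ b != 0 by rewrite expf_neq0.
move: y0 jb jb'; move: (_ ^+ b) (_ ^+ b) (_ ^+ b) (_ ^+ a) => x1 x2 x3 x4 n1 n2 n3.
by field; rewrite ?n1 ?n2 ?n3.
Qed.

Lemma p_sub_t : p%:Z - t%:Z = (p - t)%N%:Z.
Proof. by rewrite subzn. Qed.

Lemma Wact_wplus g z : \det g = 1 -> 0 < complex.Im z ->
  Wact g (wplus k t z) = autj g z ^ (2 * t)%N *: wplus k t (mobius g z).
Proof.
move=> dg z0; rewrite /Wact /wplus /= sym_act0; congr pair; last by rewrite scaler0.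
rewrite p_sub_t (_ : t%:Z - p%:Z = - (p - t)%N%:Z); last by rewrite -p_sub_t opprB.
rewrite sym_act_weight //; last by lia.
by congr (_ ^ _ *: _); lia.
Qed.

Lemma Wact_wminus g z : \det g = 1 -> 0 < complex.Im z ->
  Wact g (wminus k t z) = autj g z ^ (- (2 * t)%N%:Z) *: wminus k t (mobius g z).
Proof.
move=> dg z0; rewrite /Wact /wminus /= sym_act0; congr pair; first by rewrite scaler0.
rewrite p_sub_t -opprD sym_act_weight //; last by lia.
by congr (_ ^ _ *: _); lia.
Qed.

Definition diag_hom (a b : kernel) : hom_family R k t := fun z z' =>
  linfun (fun v : subvs_of (W0 k t z) =>
    (a z z' * coord (w_frame k t z) 0 v) *: tnth (w_frame k t z') 0 +
    (b z z' * coord (w_frame k t z) 1 v) *: tnth (w_frame k t z') 1).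

Lemma G_green_diag : G_green k t = diag_hom (@mu_plus R k t) (@mu_minus R k t).
Proof. by []. Qed.

Lemma diag_homE (a b : kernel) z z' v : diag_hom a b z z' v =
  (a z z' * coord (w_frame k t z) 0 v) *: tnth (w_frame k t z') 0 +
  (b z z' * coord (w_frame k t z) 1 v) *: tnth (w_frame k t z') 1.
Proof.
rewrite /diag_hom linfun_linearE // => c u u'.
have cP i : coord (w_frame k t z) i (c *: u + u') =
    c * coord (w_frame k t z) i u + coord (w_frame k t z) i u' by exact: linearP.
by rewrite !cP !mulrDr !scalerDl scalerDr !scalerA addrACA !(mulrCA c).
Qed.

Lemma coord_w_frame z (i j : 'I_2) : 0 < complex.Im z ->
  coord (w_frame k t z) j (tnth (w_frame k t z) i) = (i == j)%:R.
Proof.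
move=> z0; rewrite (tnth_nth 0) coord_free //.
by apply: basis_free; exact: w_frame_basis.
Qed.

Lemma diag_hom_plus (a b : kernel) z z' : 0 < complex.Im z ->
  diag_hom a b z z' (tnth (w_frame k t z) 0) = a z z' *: tnth (w_frame k t z') 0.
Proof. by move=> z0; rewrite diag_homE !coord_w_frame // mulr1 mulr0 scale0r addr0. Qed.

Lemma diag_hom_minus (a b : kernel) z z' : 0 < complex.Im z ->
  diag_hom a b z z' (tnth (w_frame k t z) 1) = b z z' *: tnth (w_frame k t z') 1.
Proof. by move=> z0; rewrite diag_homE !coord_w_frame // mulr1 mulr0 scale0r add0r. Qed.

Lemma hom_frame_ext z (V : vectType R[i]) (f f' : 'Hom(subvs_of (W0 k t z), V)) :
  0 < complex.Im z ->
  f (tnth (w_frame k t z) 0) = f' (tnth (w_frame k t z) 0) ->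
  f (tnth (w_frame k t z) 1) = f' (tnth (w_frame k t z) 1) -> f = f'.
Proof.
move=> z0 e0 e1; apply/lfunP => v.
have /coord_basis/(_ (memvf v)) -> := w_frame_basis tk z0.
rewrite !linear_sum; apply: eq_bigr => i _; rewrite !linearZ /= -tnth_nth.
by case: (ord2_cases i) => ->; rewrite ?e0 ?e1.
Qed.

Lemma hom_actE g g' (G : hom_family R k t) z z' v : hom_act g g' G z z' v =
  vsproj (W0 k t z') (Wact g' (vsval (G (mobius (invmx g) z) (mobius (invmx g') z')
    (vsproj (W0 k t (mobius (invmx g) z)) (Wact (invmx g) (vsval v)))))).
Proof.
apply: linfun_linearE => c u u'.
have WactP (m : 'M[R]_2) (x y : Wfibre R k) :
    Wact m (c *: x + y) = c *: Wact m x + Wact m y.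
  by rewrite /Wact /=; congr pair; rewrite sym_actD sym_actZ.
have stepP (m : 'M[R]_2) y y' (x x' : subvs_of (W0 k t y)) :
    vsproj (W0 k t y') (Wact m (vsval (c *: x + x'))) =
    c *: vsproj (W0 k t y') (Wact m (vsval x)) + vsproj (W0 k t y') (Wact m (vsval x')).
  by apply: etrans (congr1 _ (WactP m (vsval x) (vsval x'))) _; exact: linearP.
have homP (aT rT : vectType R[i]) (f : 'Hom(aT, rT)) x x' :
    f (c *: x + x') = c *: f x + f x'.
  by rewrite (linearD f) (linearZZ f).
pose z1 := mobius (invmx g) z; pose z1' := mobius (invmx g') z'.
apply: etrans (congr1 (fun x => vsproj (W0 k t z') (Wact g' (vsval (G z1 z1' x))))
  (stepP (invmx g) z z1 u u')) _.
apply: etrans (congr1 (fun x => vsproj (W0 k t z') (Wact g' (vsval x)))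
  (homP _ _ (G z1 z1') _ _)) _.
exact: stepP.
Qed.

Lemma transportZ g z z' c (v : subvs_of (W0 k t z)) :
  vsproj (W0 k t z') (Wact g (vsval (c *: v))) =
  c *: vsproj (W0 k t z') (Wact g (vsval v)).
Proof.
have -> : Wact g (vsval (c *: v)) = c *: Wact g (vsval v).
  by rewrite /Wact /=; congr pair; rewrite sym_actZ.
exact: linearZZ.
Qed.

(** The target point is tied to [mobius g z] by an equation because the fibre depends on it, and
    [g' (g'^-1 z') = z'] holds only propositionally. *)
Lemma transport_plus g z z' : \det g = 1 -> 0 < complex.Im z -> mobius g z = z' ->
  vsproj (W0 k t z') (Wact g (vsval (tnth (w_frame k t z) 0))) =
  autj g z ^ (2 * t)%N *: tnth (w_frame k t z') 0.
Proof.
move=> dg z0 <-; have -> : vsval (tnth (w_frame k t z) 0) = wplus k t z.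
  by rewrite /tnth /= vsprojK ?wplus_in.
by rewrite Wact_wplus //; exact: linearZZ.
Qed.

Lemma transport_minus g z z' : \det g = 1 -> 0 < complex.Im z -> mobius g z = z' ->
  vsproj (W0 k t z') (Wact g (vsval (tnth (w_frame k t z) 1))) =
  autj g z ^ (- (2 * t)%N%:Z) *: tnth (w_frame k t z') 1.
Proof.
move=> dg z0 <-; have -> : vsval (tnth (w_frame k t z) 1) = wminus k t z.
  by rewrite /tnth /= vsprojK ?wminus_in.
by rewrite Wact_wminus //; exact: linearZZ.
Qed.

(** On [w^+] the three maps multiply by [j(g^-1, z)^(2t)], by [a] and by [j(g', g'^-1 z')^(2t)]. The
    hypotheses on [a'] and [b'] concern the one point [(z, z')], so the lemma serves both the single
    terms and the invariance of the sum. *)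
Lemma hom_act_diag g g' (a b a' b' : kernel) z z' :
  \det g = 1 -> \det g' = 1 -> 0 < complex.Im z -> 0 < complex.Im z' ->
  let z1 := mobius (invmx g) z in let z1' := mobius (invmx g') z' in
  a' z z' = autj (invmx g) z ^ (2 * t)%N * a z1 z1' * autj g' z1' ^ (2 * t)%N ->
  b' z z' = autj (invmx g) z ^ (- (2 * t)%N%:Z) * b z1 z1' * autj g' z1' ^ (- (2 * t)%N%:Z) ->
  hom_act g g' (diag_hom a b) z z' = diag_hom a' b' z z'.
Proof.
move=> dg dg' z0 z0' z1 z1' ea eb.
have dV (m : 'M[R]_2) : \det m = 1 -> \det (invmx m) = 1.
  by move=> dm; rewrite det_inv dm invr1.
have z10 : 0 < complex.Im z1 by apply: Im_mobius_gt0 => //; exact: dV.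
have z10' : 0 < complex.Im z1' by apply: Im_mobius_gt0 => //; exact: dV.
have gz1' : mobius g' z1' = z'.
  rewrite -mobiusM ?autj_neq0 ?dV ?oner_eq0 // mulmxV ?unitmxE ?dg' ?unitr1 //.
  by rewrite /mobius /autj !mxE /= !(mul0r, add0r, mul1r, addr0) divr1.
have homZ (aT rT : vectType R[i]) (f : 'Hom(aT, rT)) c x : f (c *: x) = c *: f x.
  exact: linearZZ.
apply: hom_frame_ext; [exact: z0|rewrite hom_actE|rewrite hom_actE].
  apply: etrans (congr1 (fun x => vsproj _ (Wact g' (vsval (diag_hom a b z1 z1' x))))
    (transport_plus (dV _ dg) z0 (erefl z1))) _.
  apply: etrans (congr1 (fun x => vsproj _ (Wact g' (vsval x))) (homZ _ _ _ _ _)) _.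
  apply: etrans (congr1 (fun x => vsproj _ (Wact g' (vsval (_ *: x))))
    (diag_hom_plus a b z1' z10)) _.
  apply: etrans (transportZ _ _ _ _) _.
  apply: etrans (congr1 _ (transportZ _ _ _ _)) _.
  apply: etrans (congr1 _ (congr1 _ (transport_plus dg' z10' gz1'))) _.
  apply: etrans _ (esym (diag_hom_plus a' b' z' z0)).
  by rewrite !scalerA ea.
apply: etrans (congr1 (fun x => vsproj _ (Wact g' (vsval (diag_hom a b z1 z1' x))))
  (transport_minus (dV _ dg) z0 (erefl z1))) _.
apply: etrans (congr1 (fun x => vsproj _ (Wact g' (vsval x))) (homZ _ _ _ _ _)) _.
apply: etrans (congr1 (fun x => vsproj _ (Wact g' (vsval (_ *: x))))
  (diag_hom_minus a b z1' z10)) _.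
apply: etrans (transportZ _ _ _ _) _.
apply: etrans (congr1 _ (transportZ _ _ _ _)) _.
apply: etrans (congr1 _ (congr1 _ (transport_minus dg' z10' gz1'))) _.
apply: etrans _ (esym (diag_hom_minus a' b' z' z0)).
by rewrite !scalerA eb.
Qed.

Lemma hom_mx_diag (a b : kernel) z z' (i j : 'I_2) :
  0 < complex.Im z -> 0 < complex.Im z' ->
  hom_mx (diag_hom a b) (z, z') i j =
    if i == j then (if i == 0 then a z z' else b z z') else 0.
Proof.
move=> z0 z0'; rewrite /hom_mx mxE /=.
by case: (ord2_cases i) => ->; rewrite ?diag_hom_plus ?diag_hom_minus // linearZ /=
   coord_w_frame //; case: (ord2_cases j) => ->; rewrite /= ?mulr1 ?mulr0.
Qed.

End HomFamilies.

(** * Conjugation in Gamma(M) *)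

Section GammaAction.
Variables (R : realType) (M : nat).
Implicit Types (g h : 'M[int]_2).

Lemma in_GammaP g :
  reflect (\det g = 1 /\ exists X, g = 1%:M + M%:Z *: X) (in_Gamma M g).
Proof.
apply: (iffP andP) => -[].
  move=> /eqP dg /forallP gM; split=> //.
  exists (\matrix_(i, j) divz (g i j - (1%:M : 'M[int]_2) i j) M).
  apply/matrixP => i j.
  transitivity ((1%:M : 'M[int]_2) i j + M%:Z * divz (g i j - (1%:M : 'M[int]_2) i j) M).
    move: (gM i) => /forallP /(_ j); rewrite eqz_mod_dvd => dv.
    by rewrite mulrC divzK // addrC subrK.
  by rewrite [RHS]mxE; congr (_ + _); rewrite !mxE.
move=> dg [X gX]; split; first exact/eqP.
apply/forallP => i; apply/forallP => j; rewrite eqz_mod_dvd gX !mxE addrAC subrr add0r.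
exact: dvdz_mulr.
Qed.

Lemma in_GammaM g h : in_Gamma M g -> in_Gamma M h -> in_Gamma M (g *m h).
Proof.
move=> /in_GammaP[dg [X gX]] /in_GammaP[dh [Y hY]]; apply/in_GammaP.
split; first by rewrite det_mulmx dg dh.
exists (Y + X *m h); rewrite {1}gX mulmxDl mul1mx {1}hY -scalemxAl scalerDr addrA.
by [].
Qed.

Lemma in_GammaV g : in_Gamma M g -> in_Gamma M (invmx g).
Proof.
move=> /in_GammaP[dg [X gX]]; apply/in_GammaP.
have ug : g \in unitmx by rewrite unitmxE dg unitr1.
split; first by rewrite det_inv dg invr1.
exists (- (invmx g *m X)); rewrite scalerN scalemxAr.
have -> : M%:Z *: X = g - 1%:M by rewrite gX addrAC subrr add0r.
by rewrite mulmxBr mulmx1 mulVmx // opprB addrC subrK.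
Qed.

(** The two-sided translation [x |-> g x h^-1], a conjugation only for [g = h]. *)
Definition conj_Gamma (g h : Gamma M) (x : Gamma M) : Gamma M :=
  Sub (val g *m val x *m invmx (val h))
    (in_GammaM (in_GammaM (valP g) (valP x)) (in_GammaV (valP h))).

Definition inv_Gamma (g : Gamma M) : Gamma M := Sub (invmx (val g)) (in_GammaV (valP g)).

Lemma Gamma_unit (g : Gamma M) : val g \in unitmx.
Proof. by rewrite unitmxE Gamma_det unitr1. Qed.

Lemma conj_GammaK (g h : Gamma M) :
  cancel (conj_Gamma g h) (conj_Gamma (inv_Gamma g) (inv_Gamma h)).
Proof.
move=> x; apply: val_inj; rewrite /= invmxK -!mulmxA mulVmx ?Gamma_unit // mulmx1.
by rewrite mulKmx ?Gamma_unit.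
Qed.

Lemma conj_GammaVK (g h : Gamma M) :
  cancel (conj_Gamma (inv_Gamma g) (inv_Gamma h)) (conj_Gamma g h).
Proof.
move=> x; apply: val_inj; rewrite /= invmxK -!mulmxA mulmxV ?Gamma_unit // mulmx1.
by rewrite mulKVmx ?Gamma_unit.
Qed.

Lemma Gamma_mx_conj (g h x : Gamma M) :
  Gamma_mx R (conj_Gamma g h x) *m Gamma_mx R h = Gamma_mx R g *m Gamma_mx R x.
Proof. by rewrite /Gamma_mx /intmx -!map_mxM /= mulmxKV ?Gamma_unit. Qed.

End GammaAction.

(** * The sum over Gamma(M) *)

Section GreenSum.
Variables (R : realType) (M k t : nat).
Hypotheses (t0 : (0 < t)%N) (tk : (t <= k - 1)%N).
Local Open Scope complex_scope.
Implicit Types (z w : R[i]).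
Local Notation kernel := (R[i] -> R[i] -> R[i]).

Definition gamma_term (n : int) (F : kernel) (g : Gamma M) (q : R[i] * R[i]) : R[i] :=
  green_term n F (Gamma_mx R g) q.

Definition gamma_sum (n : int) (F : kernel) : kernel :=
  fun z w => sum (fun g : Gamma M => gamma_term n F g (z, w)).

Lemma ltn_t_k : (t < k)%N.
Proof. lia. Qed.

Lemma gamma_term_dominated (n : int) (F : kernel) z w : green_bounded k t n F ->
  0 < complex.Im z -> 0 < complex.Im w ->
  exists v : Gamma M -> R, exists S : R, exists J : {fset Gamma M},
    [/\ forall g, 0 <= v g, forall A : {fset Gamma M}, partial_sum v A <= S &
      \forall q \near (z, w), forall g, g \notin J -> `|gamma_term n F g q| <= (v g)%:C].
Proof.
move=> bF z0 w0; have [C [J [C0 dom]]] := @green_term_dominated R k t t0 ltn_t_k n F M z w bF z0 w0.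
exists (fun g => C * (frob (Gamma_mx R g))^-1 ^+ 2), (C * (36 * (6 * (6 * 6)))), J; split.
- by move=> g; rewrite mulr_ge0 ?sqr_ge0.
- move=> A; rewrite partial_sumE -mulr_sumr ler_wpM2l //.
  by have := @frob_sum_le R M A; rewrite partial_sumE.
- exact: dom.
Qed.

Lemma gamma_sum_cvg (n : int) (F : kernel) z w : green_bounded k t n F ->
  0 < complex.Im z -> 0 < complex.Im w ->
  partial_sum (fun g => gamma_term n F g (z, w)) @ totally --> gamma_sum n F z w.
Proof.
move=> bF z0 w0; have [v [S [J [v0 vS dom]]]] := gamma_term_dominated bF z0 w0.
exact: (dominated_sum_cvg v0 vS (nbhs_singleton dom)).
Qed.

Lemma gamma_sum_near (n : int) (F : kernel) z w : green_bounded k t n F ->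
  0 < complex.Im z -> 0 < complex.Im w ->
  forall e : R[i], 0 < e -> exists A0 : {fset Gamma M},
    \forall q \near (z, w), forall A : {fset Gamma M}, (A0 `<=` A)%fset ->
      `|gamma_sum n F q.1 q.2 - partial_sum (fun g => gamma_term n F g q) A| < e.
Proof.
move=> bF z0 w0 e e0; have [v [S [J [v0 vS dom]]]] := gamma_term_dominated bF z0 w0.
have [A0 un] := dominated_sum_near v0 vS dom e0.
by exists A0; apply: filterS un => -[z' w'] un A /un.
Qed.

Lemma gamma_sum_continuous (n : int) (F : kernel) z w : green_bounded k t n F ->
  off_diag_continuous F -> 0 < complex.Im z -> 0 < complex.Im w ->
  (forall g : Gamma M, z <> mobius (Gamma_mx R g) w) ->
  gamma_sum n F q.1 q.2 @[q --> (z, w)] --> gamma_sum n F z w.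
Proof.
move=> bF cF z0 w0 zw; have [v [S [J [v0 vS dom]]]] := gamma_term_dominated bF z0 w0.
have ct (g : Gamma M) : gamma_term n F g q @[q --> (z, w)] --> gamma_term n F g (z, w).
  by apply: green_term_continuous; [exact: cF|exact: Gamma_mx_det|exact: z0|exact: w0|exact: zw].
have := dominated_sum_continuous v0 vS dom ct.
rewrite (_ : (fun q => gamma_sum n F q.1 q.2) = fun q => sum ((gamma_term n F)^~ q)) //.
Qed.

(** After reindexing by [conj_Gamma g h], every term acquires the same automorphy factor. *)
Lemma gamma_sum_mobius (n : int) (F : kernel) (g h : Gamma M) z w :
  green_bounded k t n F -> equivariant n F -> 0 < complex.Im z -> 0 < complex.Im w ->
  gamma_sum n F (mobius (Gamma_mx R g) z) (mobius (Gamma_mx R h) w) =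
  autj (Gamma_mx R g) z ^ (- n) * autj (Gamma_mx R h) w ^ n * gamma_sum n F z w.
Proof.
move=> bF eF z0 w0; have dg := Gamma_mx_det R g; have dh := Gamma_mx_det R h.
have z1 := Im_mobius_gt0 dg z0; have w1 := Im_mobius_gt0 dh w0.
rewrite {1}/gamma_sum -(sum_reindex (conj_GammaK g h) (conj_GammaVK g h)); last first.
  exact: gamma_sum_cvg.
rewrite -sumZ; last exact: gamma_sum_cvg.
congr sum; apply/funext => x; apply: green_term_mobius => //; try exact: Gamma_mx_det.
by rewrite Gamma_mx_conj.
Qed.

Lemma Gamma_mx_inv (g : Gamma M) : Gamma_mx R (inv_Gamma g) = invmx (Gamma_mx R g).
Proof.
have ug : Gamma_mx R g \in unitmx by rewrite unitmxE Gamma_mx_det unitr1.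
apply: (can_inj (mulmxK ug)); rewrite mulVmx //.
by rewrite /Gamma_mx /intmx -map_mxM /= mulVmx ?Gamma_unit // map_mx1.
Qed.

Lemma mobius1 z : mobius 1%:M z = z.
Proof. by rewrite /mobius /autj !mxE /= !(mul0r, add0r, mul1r, addr0) divr1. Qed.

Lemma autj1 z : autj 1%:M z = 1.
Proof. by rewrite /autj !mxE /= mul0r add0r. Qed.

Lemma autjV (g : 'M[R]_2) z : \det g = 1 -> 0 < complex.Im z ->
  autj (invmx g) (mobius g z) = (autj g z)^-1.
Proof.
move=> dg z0; have jz : autj g z != 0 by rewrite autj_neq0 // dg oner_eq0.
apply: (mulIf jz); rewrite -autjM // mulVmx ?unitmxE ?dg ?unitr1 // autj1.
by rewrite mulVf.
Qed.

Definition green_sum_hom : hom_family R k t :=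
  diag_hom k t (gamma_sum (2 * t)%N (@mu_plus R k t))
               (gamma_sum (- (2 * t)%N%:Z) (@mu_minus R k t)).

(** [gamma_sum_mobius] at the inverses of [g] and [h] gives factors inverse to those in
    [hom_act_diag], because [j(h, h^-1 z') = 1 / j(h^-1, z')]. *)
Lemma green_sum_hom_invariant (g h : Gamma M) z z' :
  0 < complex.Im z -> 0 < complex.Im z' ->
  hom_act (Gamma_mx R g) (Gamma_mx R h) green_sum_hom z z' = green_sum_hom z z'.
Proof.
move=> z0 z0'; have dg := Gamma_mx_det R g; have dh := Gamma_mx_det R h.
have dV (x : Gamma M) : \det (invmx (Gamma_mx R x)) = 1.
  by rewrite -Gamma_mx_inv Gamma_mx_det.
have jg : autj (invmx (Gamma_mx R g)) z != 0 by rewrite autj_neq0 // dV oner_eq0.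
have jh : autj (invmx (Gamma_mx R h)) z' != 0 by rewrite autj_neq0 // dV oner_eq0.
have jV : autj (Gamma_mx R h) (mobius (invmx (Gamma_mx R h)) z') =
    (autj (invmx (Gamma_mx R h)) z')^-1.
  by rewrite -{1}[Gamma_mx R h]invmxK autjV.
apply: hom_act_diag => //; rewrite jV -!Gamma_mx_inv gamma_sum_mobius //.
- rewrite !Gamma_mx_inv !exprz_inv -!invr_expz.
  have := expfz_neq0 (2 * t)%N jg; have := expfz_neq0 (2 * t)%N jh.
  move: (_ ^ _) (_ ^ _) (gamma_sum _ _ _ _) => x y s x0 y0.
  by field; rewrite x0 y0.
- exact: mu_plus_bounded.
- exact: mu_plus_equivariant.
- rewrite !Gamma_mx_inv !exprz_inv -!invr_expz.
  have := expfz_neq0 (2 * t)%N jg; have := expfz_neq0 (2 * t)%N jh.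
  rewrite !invrK; move: (_ ^ _) (_ ^ _) (gamma_sum _ _ _ _) => x y s x0 y0.
  by field; rewrite x0 y0.
- exact: mu_minus_bounded.
- exact: mu_minus_equivariant.
Qed.

(** Evaluating at [(z, g z')] and pulling back by [g^-1] produces [j(g^-1, g z')^n = j(g, z')^(-n)],
    which gives the explicit form of the series. *)
Lemma hom_act_G_green (g : Gamma M) z z' : 0 < complex.Im z -> 0 < complex.Im z' ->
  hom_act 1%:M (invmx (Gamma_mx R g)) (@G_green R k t) z z' =
  diag_hom k t (fun z z' => gamma_term (2 * t)%N (@mu_plus R k t) g (z, z'))
    (fun z z' => gamma_term (- (2 * t)%N%:Z) (@mu_minus R k t) g (z, z')) z z'.
Proof.
move=> z0 z0'; have dg := Gamma_mx_det R g.
have jg : autj (Gamma_mx R g) z' != 0 by rewrite autj_neq0 // dg oner_eq0.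
have i1 : invmx 1%:M = 1%:M :> 'M[R]_2.
  by apply: (can_inj (mulmxK (unitmx1 _ _))); rewrite mulVmx ?unitmx1 // mulmx1.
rewrite G_green_diag; apply: hom_act_diag => //; rewrite ?det1 //.
- by rewrite det_inv dg invr1.
- rewrite i1 invmxK mobius1 autj1 exp1rz mul1r autjV // exprz_inv mulrC.
  by [].
- rewrite i1 invmxK mobius1 autj1 exp1rz mul1r autjV // exprz_inv mulrC.
  by [].
Qed.

Lemma hom_mx_G_partial (A : {fset Gamma M}) z z' (i j : 'I_2) :
  0 < complex.Im z -> 0 < complex.Im z' ->
  hom_mx (G_partial R k t A) (z, z') i j =
  hom_mx (diag_hom k t
    (fun z z' => partial_sum (fun g => gamma_term (2 * t)%N (@mu_plus R k t) g (z, z')) A)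
    (fun z z' => partial_sum (fun g => gamma_term (- (2 * t)%N%:Z) (@mu_minus R k t) g (z, z')) A))
    (z, z') i j.
Proof.
move=> z0 z0'; rewrite hom_mx_diag // /hom_mx mxE /= /G_partial partial_sumE.
rewrite sum_lfunE linear_sum /=.
transitivity (\sum_(g <- A) hom_mx (diag_hom k t
    (fun z z' => gamma_term (2 * t)%N (@mu_plus R k t) g (z, z'))
    (fun z z' => gamma_term (- (2 * t)%N%:Z) (@mu_minus R k t) g (z, z'))) (z, z') i j).
  by apply: eq_bigr => g _; rewrite hom_act_G_green // [in RHS]/hom_mx mxE.
rewrite !partial_sumE; under eq_bigr do rewrite hom_mx_diag //.
by case: eqP => _; [case: eqP|rewrite big1].
Qed.

End GreenSum.

(** * From the entries to the matrices, and the theorem *)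

Lemma cvg_mx22 (R : realType) (T : Type) (G : set_system T) (FG : Filter G)
    (f : T -> 'M[R[i]]_2) (A : 'M[R[i]]_2) :
  (forall i j, f x i j @[x --> G] --> A i j) -> f x @[x --> G] --> A.
Proof.
move=> fA P [Q QA QP]; rewrite /nbhs /=.
have h i j : G [set x | Q i j (f x i j)] by apply: fA; exact: QA.
apply: filterS (filterI (filterI (h 0 0) (h 0 1)) (filterI (h 1 0) (h 1 1))).
move=> x [[x00 x01] [x10 x11]]; apply: QP => i j.
by case: (ord2_cases i) => ->; case: (ord2_cases j) => ->.
Qed.

Lemma cvg_near_eq (T U : topologicalType) (p : T) (f g : T -> U) :
  (\forall q \near p, f q = g q) ->
  f q @[q --> p] --> f p -> g q @[q --> p] --> g p.
Proof.
move=> fg fp P; rewrite -(nbhs_singleton fg) => /fp fP.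
by apply: filterS2 fg fP => q /= ->.
Qed.

Lemma near_Im_gt0 (R : realType) (z w : R[i]) :
  0 < complex.Im z -> 0 < complex.Im w ->
  \forall q \near (z, w), 0 < complex.Im q.1 /\ 0 < complex.Im q.2.
Proof.
move=> z0 w0; near=> q; split; near: q.
  by move: z0; apply: cvgr_gt; apply: cvg_Im; exact: cvg_fst.
by move: w0; apply: cvgr_gt; apply: cvg_Im; exact: cvg_snd.
Unshelve. all: by end_near. Qed.

Lemma hom_mx_diag_continuous (R : realType) (k t : nat) (a b : R[i] -> R[i] -> R[i])
    (z w : R[i]) : (t <= k - 1)%N -> 0 < complex.Im z -> 0 < complex.Im w ->
  a q.1 q.2 @[q --> (z, w)] --> a z w -> b q.1 q.2 @[q --> (z, w)] --> b z w ->
  {for (z, w), continuous (hom_mx (diag_hom k t a b))}.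
Proof.
move=> tk z0 w0 ca cb; apply: cvg_mx22 => i j.
have nI := near_Im_gt0 z0 w0.
pose f (q : R[i] * R[i]) : R[i] :=
  if i == j then (if i == 0 then a q.1 q.2 else b q.1 q.2) else 0.
have cf : f q @[q --> (z, w)] --> f (z, w).
  rewrite /f; case: (i == j); last exact: cvg_cst.
  by case: (i == 0); [exact: ca|exact: cb].
apply: (cvg_near_eq _ cf).
by apply: filterS nI => -[z' w'] [z0' w0']; rewrite /f hom_mx_diag.
Qed.

Theorem lemma8p2 (R : realType) (M k t : nat)
    (hM : (3 <= M)%N) (ht0 : (0 < t)%N) (htk : (t <= k - 1)%N) :
  exists s : {unit 'Z_M} -> {unit 'Z_M} -> hom_family R k t,
    is_hom_section s /\
    (forall (c : {unit 'Z_M}) (K : set (R[i] * R[i])),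
       compact K -> K `<=` off_diag R c c ->
       {uniform K, (fun A : {fset Gamma M} => hom_mx (G_partial R k t A))
                     @ totally --> hom_mx (s c c)}) /\
    (forall (c c' : {unit 'Z_M}) (z z' : R[i]),
       c <> c' -> off_diag R c c' (z, z') -> s c c' z z' = 0).
Proof.
pose zero : R[i] -> R[i] -> R[i] := fun _ _ => 0.
(* Only components with equal index carry the sum. The zero section on the others is written as a
   diagonal family so that the lemmas on [diag_hom] cover it. *)
exists (fun c c' : {unit 'Z_M} => if c == c' then @green_sum_hom R M k t else diag_hom k t zero zero).
have bp := @mu_plus_bounded R k t; have bm := @mu_minus_bounded R k t.
split; [|split].
- move=> c c'; split.
    move=> g g' z z' [/= z0 z0' _]; case: ifP => _.
      exact: green_sum_hom_invariant.
    apply: hom_act_diag => //; try exact: Gamma_mx_det.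
      by rewrite mulr0 mul0r.
    by rewrite mulr0 mul0r.
  apply: continuous_in_subspaceT => -[z z'] /set_mem [/= z0 z0' zz'].
  case: eqP => [cc'|_].
    have tk := ltn_t_k ht0 htk; apply: hom_mx_diag_continuous => //.
      by apply: (gamma_sum_continuous ht0 htk bp) (zz' cc'); first exact: mu_plus_continuous.
    by apply: (gamma_sum_continuous ht0 htk bm) (zz' cc'); first exact: mu_minus_continuous.
  by apply: hom_mx_diag_continuous => //; exact: cvg_cst.
- move=> c K cK KO; rewrite eqxx => P /uniform_nbhs[E [+ EP]].
  rewrite -entourage_ballE => -[e /= e0 eE].
  have FF := @totally_filter (Gamma M).
  pose close (A : {fset Gamma M}) (q : R[i] * R[i]) := forall i j,
    `|hom_mx (@green_sum_hom R M k t) q i j - hom_mx (G_partial R k t A) q i j| < e.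
  (* Compactness as near covering: it suffices that each point of [K] has a neighbourhood and a
     finite set beyond which all partial sums are [e]-close there. *)
  suff /((compact_near_coveringP K).1 cK _ totally close FF)[A0 _ A0K] : forall x, K x ->
      \forall x' \near x & A \near totally, close A x'.
    by exists A0 => // A /A0K KA; apply: EP => q Kq; apply: eE; split => // i j; exact: (KA q Kq).
  move=> [z z'] /KO[/= z0 z0' _].
  have [Ap hp] := gamma_sum_near M ht0 htk bp z0 z0' e0.
  have [Am hm] := gamma_sum_near M ht0 htk bm z0 z0' e0.
  (* [Ap] and [Am] serve the two diagonal entries, and their union serves the matrix. *)
  exists ([set q | (0 < complex.Im q.1 /\ 0 < complex.Im q.2) /\
      ((forall A : {fset Gamma M}, (Ap `<=` A)%fset ->
       `|gamma_sum M (2 * t)%N (@mu_plus R k t) q.1 q.2 -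
       partial_sum (fun g => gamma_term (2 * t)%N (@mu_plus R k t) g q) A| < e) /\
      (forall A : {fset Gamma M}, (Am `<=` A)%fset ->
       `|gamma_sum M (- (2 * t)%N%:Z) (@mu_minus R k t) q.1 q.2 -
       partial_sum (fun g => gamma_term (- (2 * t)%N%:Z) (@mu_minus R k t) g q) A| < e))],
    [set A | (Ap `|` Am `<=` A)%fset]) => /=.
    split; last by exists (Ap `|` Am)%fset.
    exact: filterI (near_Im_gt0 z0 z0') (filterI hp hm).
  move=> [[w w'] A] /= [[[w0 w0'] [dp dm]] /[!fsubUset] /andP[pA mA]] i j.
  rewrite hom_mx_G_partial // !hom_mx_diag //.
  case: (i == j); last by rewrite subr0 normr0.
  by case: (i == 0); [exact: dp|exact: dm].
- move=> c c' z z' /eqP/negbTE -> _; apply/lfunP => v.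
  by rewrite diag_homE !mul0r !scale0r addr0 zero_lfunE.
Qed.
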